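(* Let $k$ be a positive integer with $k\equiv 171\pmod{343}$, and let $t\in\{96,292,341\}$. Then for all integers $n\geq 0$, $$\Delta_{k}(343n+t)\equiv 0\pmod{49}.$$
   Context: For a positive integer $k$, $\Delta_k(n)$ denotes the number of broken $k$-diamond partitions of $n$ (Andrews and Paule). The integers $\Delta_k(n)$, $n\ge 0$, are determined by the generating function $$\sum_{n=0}^{\infty}\Delta_{k}(n)q^{n}=\frac{(q^{2};q^{2})_{\infty}\,(q^{2k+1};q^{2k+1})_{\infty}}{(q;q)_{\infty}^{3}\,(q^{2(2k+1)};q^{2(2k+1)})_{\infty}},$$ where $|q|<1$ (or as formal power series in $q$) and $(a;q)_{\infty}:=\prod_{n=0}^{\infty}(1-aq^{n})$. This identity may be taken as the definition of $\Delta_k(n)$. *)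

(* Defs.v *)
From mathcomp Require Import all_boot all_order all_algebra.
Set Implicit Arguments.
Unset Strict Implicit.
Unset Printing Implicit Defensive.
Import Order.TTheory GRing.Theory Num.Theory.
Local Open Scope ring_scope.

(* A formal power series in q over the integers is its coefficient function;
   equality of series is pointwise equality. *)
Definition series := nat -> int.

Definition ser_one : series := fun n => (n == 0)%:R.

Definition ser_mul (f g : series) : series :=
  fun n => \sum_(i < n.+1) f i * g (n - i)%N.

Definition ser_exp (f : series) (m : nat) : series :=
  iter m (ser_mul f) ser_one.

(* [ser_inv_coefs f n] lists the first n coefficients of 1/f.  Only meaningful
   when the constant term of f is 1; see [ser_mulV]. *)
Fixpoint ser_inv_coefs (f : series) (n : nat) : seq int :=
  if n is m.+1 then
    let s := ser_inv_coefs f m in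
    rcons s (if m is 0 then 1 else - \sum_(i < m) f (m - i)%N * s`_i)
  else [::].

Definition ser_inv (f : series) : series := fun n => (ser_inv_coefs f n.+1)`_n.

Definition ser_div (f g : series) : series := ser_mul f (ser_inv g).

(* The partial product \prod_(m < N) (1 - q^a (q^b)^m) of (q^a; q^b)_oo. *)
Definition qpoch_trunc (a b N : nat) : {poly int} :=
  \prod_(m < N) (1 - 'X^(a + b * m)).

(* (q^a; q^b)_oo for a, b >= 1: its n-th coefficient is the eventual value of
   the n-th coefficient of the partial products, which is reached from
   n factors on; see [qpochE]. *)
Definition qpoch (a b : nat) : series := fun n => (qpoch_trunc a b n)`_n.

Definition broken_diamond_num (k : nat) : series :=
  ser_mul (qpoch 2 2) (qpoch (2 * k + 1) (2 * k + 1)).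

Definition broken_diamond_den (k : nat) : series :=
  ser_mul (ser_exp (qpoch 1 1) 3)
          (qpoch (2 * (2 * k + 1)) (2 * (2 * k + 1))).

(* The number of broken k-diamond partitions of n, defined by its
   generating function. *)
Definition Delta (k : nat) : series :=
  ser_div (broken_diamond_num k) (broken_diamond_den k).

Lemma qpochE (a b n N : nat) : (0 < a)%N -> (0 < b)%N -> (n <= N)%N ->
  (qpoch_trunc a b N)`_n = qpoch a b n.
Proof.
move=> a_gt0 b_gt0 /subnK <-; elim: (N - n)%N => // d IHd.
rewrite addSn /qpoch_trunc big_ord_recr /= mulrBr mulr1 coefB.
rewrite -/(qpoch_trunc _ _ _) IHd coefMXn ifT ?subr0 //.
rewrite (@leq_trans (a + (d + n))) // -?[n.+1]add1n.
  by rewrite leq_add // leq_addl.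
by rewrite leq_add2l leq_pmull.
Qed.

Lemma qpoch0 (a b : nat) : qpoch a b 0 = 1.
Proof. by rewrite /qpoch /qpoch_trunc big_ord0 coef1. Qed.

Lemma size_ser_inv_coefs (f : series) n : size (ser_inv_coefs f n) = n.
Proof. by elim: n => //= n IHn; rewrite size_rcons IHn. Qed.

Lemma nth_ser_inv_coefs (f : series) m n : (n < m)%N ->
  (ser_inv_coefs f m)`_n = ser_inv f n.
Proof.
elim: m => // m IHm; rewrite ltnS leq_eqVlt => /predU1P[-> //| lt_nm].
by rewrite /= nth_rcons size_ser_inv_coefs lt_nm IHm.
Qed.

Lemma ser_inv0 (f : series) : ser_inv f 0 = 1.
Proof. by []. Qed.

Lemma ser_invS (f : series) n :
  ser_inv f n.+1 = - \sum_(i < n.+1) f (n.+1 - i)%N * ser_inv f i.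
Proof.
have -> : ser_inv f n.+1 =
    (rcons (ser_inv_coefs f n.+1)
       (- \sum_(i < n.+1) f (n.+1 - i)%N * (ser_inv_coefs f n.+1)`_i))`_n.+1.
  by [].
rewrite nth_rcons size_ser_inv_coefs ltnn eqxx.
by congr (- _); apply: eq_bigr => i _; rewrite nth_ser_inv_coefs.
Qed.

Lemma ser_mulC (f g : series) n : ser_mul f g n = ser_mul g f n.
Proof.
rewrite /ser_mul (reindex_inj rev_ord_inj) /=; apply: eq_bigr => i _.
by rewrite subSS subKn 1?mulrC // -ltnS.
Qed.

Lemma ser_mulV (f : series) n : f 0 = 1 -> ser_mul f (ser_inv f) n = ser_one n.
Proof.
move=> f0; rewrite ser_mulC /ser_mul big_ord_recr /= subnn f0 mulr1.
case: n => [|n]; first by rewrite big_ord0 add0r ser_inv0.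
rewrite ser_invS; apply/eqP; rewrite subr_eq0; apply/eqP.
by apply: eq_bigr => i _; rewrite mulrC.
Qed.

Lemma ser_mul_poly (f g : series) N n : (n < N)%N ->
  ser_mul f g n = ((\poly_(i < N) f i) * (\poly_(i < N) g i))`_n.
Proof.
move=> lt_nN; rewrite coefM; apply: eq_bigr => i _; rewrite !coef_poly.
have lt_iN : (i < N)%N by apply: leq_ltn_trans lt_nN; rewrite -ltnS.
by rewrite lt_iN (leq_ltn_trans (leq_subr _ _) lt_nN).
Qed.

Lemma ser_mulA (f g h : series) n :
  ser_mul f (ser_mul g h) n = ser_mul (ser_mul f g) h n.
Proof.
pose P (u : series) := \poly_(i < n.+1) u i.
transitivity ((P f * (P g * P h))`_n).
  rewrite coefM; apply: eq_bigr => i _; rewrite coef_poly ltn_ord.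
  by rewrite -(ser_mul_poly g h) // ltnS leq_subr.
rewrite mulrA coefM; apply: eq_bigr => i _.
by rewrite coef_poly ltnS leq_subr -(ser_mul_poly f g).
Qed.

Lemma ser_mul1 (f : series) n : ser_mul f ser_one n = f n.
Proof.
rewrite /ser_mul big_ord_recr /= subnn mulr1 big1 ?add0r // => i _.
by rewrite /ser_one subn_eq0 leqNgt ltn_ord mulr0.
Qed.

Lemma ser_mul_divK (f g : series) n : g 0 = 1 -> ser_mul (ser_div f g) g n = f n.
Proof.
move=> g0; rewrite -ser_mulA -[RHS]ser_mul1; apply: eq_bigr => i _.
by rewrite ser_mulC ser_mulV.
Qed.

Lemma Delta_gf (k n : nat) :
  ser_mul (Delta k) (broken_diamond_den k) n = broken_diamond_num k n.
Proof.
have mul0 f g : ser_mul f g 0 = f 0 * g 0 by rewrite /ser_mul big_ord1.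
by apply: ser_mul_divK; rewrite /broken_diamond_den /ser_exp /= !mul0 !qpoch0.
Qed.

(* Main.v *)
Require Import Defs.
From HB Require Import structures.
From mathcomp Require Import all_boot all_order all_algebra.
From mathcomp Require Import boolp.
From mathcomp Require Import ring zify.
From Stdlib Require NArith.
Import Order.TTheory GRing.Theory Num.Theory.
Set Implicit Arguments.
Unset Strict Implicit.
Unset Printing Implicit Defensive.
Local Open Scope ring_scope.

(** Why the theorem holds. Write E(q) for the product of the 1 - q^n, n >= 1, and
    D for q d/dq. Since 343 divides 2 k + 1, the generating function of Delta k is
    h = E(q^2) / E(q)^3 times a power series in q^343, so it is enough that the
    coefficients of h of index 343 j + t are divisible by 49. Write
    t = 7 (7 r + 6) + 5; then r is 1, 5 or 6, and three sections of power 7 are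
    taken in succession:
    - the coefficients of h of index 5 modulo 7 form
      E(q)^3 E(q^14) (20 + 14 A^3 - 7 S) modulo 49;
    - those of the latter of index 6 modulo 7 form 14 E(q^2) E(q^7)^3;
    - the exponents of E(q^2) are n (3 n - 1), never 1, 5 or 6 modulo 7.
    Here A = 2 P(q^2) - P(q) is the Eisenstein series of weight 2 and level 2, and
    S is the generating function of sigma_5.

    Each section is computed by differentiation. For a series f with coefficients
    f(n), the operator (1 - (D + c)^6)^2 multiplies f(n) by (1 - (n + c)^6)^2, which
    is 1 modulo 49 if 7 divides n + c and 0 otherwise ([projectE]); so a section is
    known once D is known on f. The constants c below are 1/4, 1/8 and 1/12, for
    which D + c acts on E(q)^4 E(q^2), E(q)^3 and E(q^2) as D acts on the
    corresponding products of eta functions ([shifted_E1p4E2] and the next two).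

    The derivatives come from classical differential equations in level 2. The
    quotients X = eta(tau)^16 / eta(2 tau)^8 and Y = eta(2 tau)^16 / eta(tau)^8
    satisfy A^2 = X + 64 Y, the Eisenstein series of weight 6 is
    R = A^3 - 576 A Y, and D A, D X, D Y are polynomials in P, A, Y. All of this
    follows from convolution identities between divisor sums ([sigma1_sqr] and the
    next three), which are cases of an identity of Liouville ([liouville]), and from
    the fact that a first-order linear equation determines a series
    ([first_order_ode]).

    Modulo 49 the picture collapses to one variable. First, E(q)^7 = E(q^7) (1 - 7 S)
    ([mE1_pow7]), because (1 - x)^7 / (1 - x^7) = 1 - 7 sum n^5 x^n; this also lets
    the E(q^7) on the right-hand side of a section be written with E(q). Secondly,
    R = 1 - 14 S, so that Y = 4 A^-1 (A^3 - 1 + 14 S). Thirdly, comparing two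
    expressions for the derivative of S gives P and 7 D S in terms of
    Q = A^2 + 192 Y ([mP_eq], [dq_mS]). Hence all the series needed have the form
    g(A) + 7 S h(A) with Laurent polynomials g and h, on which D acts explicitly, and
    the statements on sections become three identities between such pairs
    ([projection_identity5], [projection_identity6], [theta_identity]), which are
    computed. *)

(** * Formal power series *)

Record fps (R : Type) := Fps { coef_fps :> nat -> R }.

HB.instance Definition _ (R : Type) := gen_eqMixin (fps R).
HB.instance Definition _ (R : Type) := gen_choiceMixin (fps R).

Lemma fpsP (R : Type) (f g : fps R) : (forall n, f n = g n) -> f = g.
Proof. by case: f g => [f] [g] /= /funext ->. Qed.

Definition fps_add (R : comNzRingType) (f g : fps R) := Fps (fun n => f n + g n).
Definition fps_opp (R : comNzRingType) (f : fps R) := Fps (fun n => - f n).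
Definition fps_zero (R : comNzRingType) : fps R := Fps (fun=> 0).
Definition fps_one (R : comNzRingType) : fps R := Fps (fun n => (n == 0)%:R).
Definition fps_mul (R : comNzRingType) (f g : fps R) :=
  Fps (fun n => \sum_(i < n.+1) f i * g (n - i)%N).

Lemma fps_addA (R : comNzRingType) : associative (@fps_add R).
Proof. by move=> f g h; apply: fpsP => n; rewrite /= addrA. Qed.
Lemma fps_addC (R : comNzRingType) : commutative (@fps_add R).
Proof. by move=> f g; apply: fpsP => n; rewrite /= addrC. Qed.
Lemma fps_add0 (R : comNzRingType) : left_id (fps_zero R) (@fps_add R).
Proof. by move=> f; apply: fpsP => n; rewrite /= add0r. Qed.
Lemma fps_addN (R : comNzRingType) :
  left_inverse (fps_zero R) (@fps_opp R) (@fps_add R).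
Proof. by move=> f; apply: fpsP => n; rewrite /= addNr. Qed.
HB.instance Definition _ (R : comNzRingType) := GRing.isZmodule.Build (fps R)
  (@fps_addA R) (@fps_addC R) (@fps_add0 R) (@fps_addN R).

Definition fps_trunc (R : comNzRingType) (f : fps R) (N : nat) : {poly R} :=
  \poly_(i < N) f i.

(** Coefficients up to n of a product see only truncations, so the ring laws are
    inherited from polynomials. *)
Lemma fps_mul_trunc (R : comNzRingType) (f g : fps R) N n : (n < N)%N ->
  fps_mul f g n = (fps_trunc f N * fps_trunc g N)`_n.
Proof.
move=> lt_nN; rewrite coefM; apply: eq_bigr => i _; rewrite !coef_poly.
have lt_iN : (i < N)%N by apply: leq_ltn_trans lt_nN; rewrite -ltnS.
by rewrite lt_iN (leq_ltn_trans (leq_subr _ _) lt_nN).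
Qed.

Lemma fps_mulC (R : comNzRingType) : commutative (@fps_mul R).
Proof. by move=> f g; apply: fpsP => n; rewrite !(fps_mul_trunc _ _ (ltnSn n)) mulrC. Qed.

Lemma fps_mulA (R : comNzRingType) : associative (@fps_mul R).
Proof.
move=> f g h; apply: fpsP => n.
transitivity ((fps_trunc f n.+1 * (fps_trunc g n.+1 * fps_trunc h n.+1))`_n).
  rewrite coefM; apply: eq_bigr => i _; rewrite coef_poly ltn_ord.
  by rewrite (@fps_mul_trunc _ g h n.+1) // ltnS leq_subr.
rewrite mulrA coefM; apply: eq_bigr => i _.
by rewrite coef_poly ltnS leq_subr (@fps_mul_trunc _ f g n.+1).
Qed.

Lemma fps_mul1 (R : comNzRingType) : left_id (fps_one R) (@fps_mul R).
Proof.
move=> f; apply: fpsP => n; rewrite /= big_ord_recl subn0 /= mul1r big1 ?addr0 //.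
by move=> i _; rewrite mul0r.
Qed.

Lemma fps_mulDl (R : comNzRingType) : left_distributive (@fps_mul R) (@fps_add R).
Proof.
move=> f g h; apply: fpsP => n; rewrite /= -big_split /=.
by apply: eq_bigr => i _; rewrite mulrDl.
Qed.

Lemma fps_one_neq0 (R : comNzRingType) : fps_one R != 0.
Proof.
by apply/eqP => /(congr1 (fun f : fps R => f 0%N)) /= /eqP; rewrite oner_eq0.
Qed.

HB.instance Definition _ (R : comNzRingType) :=
  GRing.Zmodule_isComNzRing.Build (fps R) (@fps_mulA R) (@fps_mulC R)
    (@fps_mul1 R) (@fps_mulDl R) (@fps_one_neq0 R).

Section Coefficients.
Context (R : comNzRingType).
Implicit Types f g : fps R.

Lemma fpsD f g n : (f + g) n = f n + g n. Proof. by []. Qed.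
Lemma fpsN f n : (- f) n = - f n. Proof. by []. Qed.
Lemma fpsB f g n : (f - g) n = f n - g n. Proof. by []. Qed.
Lemma fps0E n : (0 : fps R) n = 0. Proof. by []. Qed.
Lemma fps1E n : (1 : fps R) n = (n == 0)%:R. Proof. by []. Qed.
Lemma fpsM f g n : (f * g) n = \sum_(i < n.+1) f i * g (n - i)%N.
Proof. by []. Qed.

Lemma fps_sum I (r : seq I) (P : pred I) (F : I -> fps R) n :
  (\sum_(i <- r | P i) F i) n = \sum_(i <- r | P i) F i n.
Proof. exact: (big_morph (fun f : fps R => f n) (fun f g => fpsD f g n)). Qed.

Lemma fpsMn f m n : (f *+ m) n = f n *+ m.
Proof. by elim: m => [|m IHm]; rewrite ?mulr0n // !mulrS fpsD IHm. Qed.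

Lemma fps_natM c f n : (c%:R * f) n = c%:R * f n.
Proof. by rewrite !mulr_natl fpsMn. Qed.

Lemma fps_mul_const0 f g : (f * g) 0 = f 0 * g 0.
Proof. by rewrite fpsM big_ord1. Qed.

(** The variable q. *)
Definition qX : fps R := Fps (fun n => (n == 1)%:R).

Lemma qXM f n : (qX * f) n = if n is m.+1 then f m else 0.
Proof.
case: n => [|n]; first by rewrite fps_mul_const0 mul0r.
rewrite fpsM big_ord_recl mul0r add0r big_ord_recl /= mul1r subSS subn0.
by rewrite big1 ?addr0 // => i _; rewrite mul0r.
Qed.

Lemma qXnM f m n : (qX ^+ m * f) n = if (m <= n)%N then f (n - m)%N else 0.
Proof.
elim: m n => [|m IHm] n; first by rewrite mul1r subn0.
by rewrite exprS -mulrA qXM; case: n => // n; rewrite IHm ltnS subSS.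
Qed.

(** The derivation q d/dq. *)
Definition dq f : fps R := Fps (fun n => f n *+ n).

Lemma dqE f n : dq f n = f n *+ n. Proof. by []. Qed.
Lemma dqD f g : dq (f + g) = dq f + dq g.
Proof. by apply: fpsP => n; rewrite /= mulrnDl. Qed.
Lemma dqN f : dq (- f) = - dq f.
Proof. by apply: fpsP => n; rewrite /= mulNrn. Qed.
HB.instance Definition _ := GRing.isZmodMorphism.Build (fps R) (fps R) dq
  (fun f g => etrans (dqD f (- g)) (congr1 (+%R (dq f)) (dqN g))).

Lemma dqB f g : dq (f - g) = dq f - dq g. Proof. exact: raddfB. Qed.

Lemma dqM f g : dq (f * g) = dq f * g + f * dq g.
Proof.
apply: fpsP => n; rewrite fpsD !fpsM /= -sumrMnl -big_split /=.
apply: eq_bigr => i _; rewrite mulrnAl mulrnAr -mulrnDr subnKC // -ltnS //.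
Qed.

Lemma dq1 : dq 1 = 0.
Proof. by apply: fpsP => -[|n]; rewrite //= mul0rn. Qed.

Lemma dq_nat c : dq c%:R = 0.
Proof. by rewrite raddfMn /= dq1 mul0rn. Qed.

Lemma dq_natM c f : dq (c%:R * f) = c%:R * dq f.
Proof. by rewrite dqM dq_nat mul0r add0r. Qed.

Lemma dqX f m : dq (f ^+ m.+1) = m.+1%:R * f ^+ m * dq f.
Proof.
elim: m => [|m IHm]; first by rewrite expr1 expr0 !mul1r.
by rewrite exprS dqM IHm; move: (dq f) => d; rewrite exprS; ring.
Qed.

(** The substitution of q^m for q. *)
Definition vq (m : nat) f : fps R :=
  Fps (fun n => if (m %| n)%N then f (n %/ m)%N else 0).

Lemma vqE m f n : vq m f n = if (m %| n)%N then f (n %/ m)%N else 0.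
Proof. by []. Qed.
Lemma vqB m f g : vq m (f - g) = vq m f - vq m g.
Proof. by apply: fpsP => n /=; case: ifP; rewrite ?subr0. Qed.
HB.instance Definition _ m := GRing.isZmodMorphism.Build (fps R) (fps R) (vq m) (@vqB m).

Lemma vq1 m : vq m.+1 1 = 1.
Proof.
apply: fpsP => n; rewrite /= /fps_one /=; have [/dvdnP[k ->]|] := boolP (_ %| n)%N.
  by rewrite mulnK // muln_eq0 orbF.
by case: n.
Qed.

Lemma vqM m f g : vq m.+1 (f * g) = vq m.+1 f * vq m.+1 g.
Proof.
have comp (h : fps R) N i : (i < N)%N ->
    vq m.+1 h i = (fps_trunc h N \Po 'X^(m.+1))`_i.
  move=> lt_iN; rewrite coef_comp_poly_Xn //=; case: ifP => // _.
  by rewrite coef_poly (leq_ltn_trans (leq_div _ _)).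
apply: fpsP => n; rewrite (comp _ n.+1) // coef_comp_poly_Xn //.
transitivity (((fps_trunc f n.+1 \Po 'X^(m.+1)) * (fps_trunc g n.+1 \Po 'X^(m.+1)))`_n).
  rewrite -comp_polyM coef_comp_poly_Xn //; case: ifP => // _.
  have lt_n : (n %/ m.+1 < n.+1)%N by rewrite ltnS leq_div.
  by rewrite coef_poly lt_n (fps_mul_trunc f g lt_n).
rewrite coefM fpsM; apply: eq_bigr => i _.
by rewrite (comp f n.+1) // (comp g n.+1) // ltnS leq_subr.
Qed.
HB.instance Definition _ m := GRing.isMonoidMorphism.Build (fps R) (fps R)
  (vq m.+1) (conj (vq1 m) (@vqM m)).

Lemma vqD m f g : vq m (f + g) = vq m f + vq m g. Proof. exact: raddfD. Qed.
Lemma vq_nat m c : vq m.+1 c%:R = c%:R. Proof. exact: rmorph_nat. Qed.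

Lemma vq_natM m c f : vq m.+1 (c%:R * f) = c%:R * vq m.+1 f.
Proof. by rewrite vqM vq_nat. Qed.
Lemma vqX m f k : vq m.+1 (f ^+ k) = vq m.+1 f ^+ k.
Proof. exact: rmorphXn. Qed.

Lemma dq_vq m f : dq (vq m f) = m%:R * vq m (dq f).
Proof.
apply: fpsP => n; rewrite fps_natM /=; case: ifP => [/dvdnP[k ->]|_].
  by case: m => [|m]; rewrite ?muln0 ?mulr0n ?mul0r // mulnK // mulr_natl mulrnA.
by rewrite mul0rn mulr0.
Qed.

Lemma vq_vq a b f : vq a.+1 (vq b.+1 f) = vq (a.+1 * b.+1) f.
Proof.
apply: fpsP => n /=; have [/dvdnP[k ->]|ndiv] := boolP (a.+1 %| n)%N.
  by rewrite mulnK // [(k * _)%N]mulnC dvdn_pmul2l // divnMl.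
by case: ifP => // /(dvdn_trans (dvdn_mulr _ (dvdnn _))); rewrite (negPf ndiv).
Qed.

(** Agreement of two series up to a fixed order; it makes sense of an infinite
    product without a topology. *)
Definition agree N f g := forall n, (n <= N)%N -> f n = g n.

Lemma agreeM N f g f' g' : agree N f f' -> agree N g g' -> agree N (f * g) (f' * g').
Proof.
move=> ff gg n le_nN; rewrite !fpsM; apply: eq_bigr => i _; rewrite ff ?gg //.
  exact: leq_trans (leq_subr _ _) le_nN.
by apply: leq_trans le_nN; rewrite -ltnS.
Qed.

Lemma agreeX N f g m : agree N f g -> agree N (f ^+ m) (g ^+ m).
Proof. by move=> fg; elim: m => [|m IHm] //; rewrite !exprS; apply: agreeM. Qed.

End Coefficients.

Opaque fps_add fps_opp fps_zero fps_one fps_mul vq dq.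

(** * Divisor sums and the identity of Liouville *)

Definition divs (n : nat) : seq nat := [seq d <- iota 1 n | (d %| n)%N].

Lemma mem_divs n d : (d \in divs n) = (0 < n)%N && (d %| n)%N.
Proof.
rewrite mem_filter mem_iota andbC; case: n => [|n]; first by case: d.
rewrite add1n ltnS; case dv: (d %| n.+1)%N; last by rewrite andbF.
by rewrite (dvdn_leq _ dv) // (dvdn_gt0 _ dv).
Qed.

Lemma divs_uniq n : uniq (divs n).
Proof. by rewrite filter_uniq // iota_uniq. Qed.

(** The Lambert series sum_d u(d) q^d / (1 - q^d). *)
Definition lambert (R : comNzRingType) (u : nat -> R) : fps R :=
  Fps (fun n => \sum_(d <- divs n) u d).

Lemma big_bij (R : nmodType) (I J : eqType) (s : seq I) (t : seq J)
    (h : I -> J) (h' : J -> I) (F : J -> R) :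
    uniq s -> uniq t ->
    {in s, forall i, h i \in t /\ h' (h i) = i} ->
    {in t, forall j, h' j \in s /\ h (h' j) = j} ->
  \sum_(j <- t) F j = \sum_(i <- s) F (h i).
Proof.
move=> us ut hP h'P; rewrite -(big_map h predT F); apply: perm_big.
apply: uniq_perm => //.
  by rewrite map_inj_in_uniq // => i j /hP[_ {2}<-] /hP[_ {2}<-] ->.
move=> j; apply/idP/mapP => [/h'P[h's hh']|[i /hP[his _] ->] //].
by exists (h' j).
Qed.

Lemma divs_codiv (R : nmodType) n (F : nat -> R) :
  \sum_(d <- divs n) F (n %/ d)%N = \sum_(d <- divs n) F d.
Proof.
symmetry; apply: (@big_bij _ _ _ _ _ (divn n) (divn n)); rewrite ?divs_uniq //;
  by move=> d; rewrite mem_divs => /andP[n0 dn];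
     rewrite mem_divs n0 dvdn_div // divnA // mulKn.
Qed.

(** The quadruples ((a, b), (x, y)) of positive integers with a x + b y = n, the
    index set of a coefficient of a product of two Lambert series. *)
Definition quads (n : nat) : seq ((nat * nat) * (nat * nat)) :=
  let r := iota 1 n in let rr := [seq (a, b) | a <- r, b <- r] in
  [seq q <- [seq (ab, xy) | ab <- rr, xy <- rr]
     | (q.1.1 * q.2.1 + q.1.2 * q.2.2 == n)%N].

Lemma pairs_uniq (S T : eqType) (s : seq S) (t : seq T) :
  uniq s -> uniq t -> uniq [seq (a, b) | a <- s, b <- t].
Proof. by move=> us ut; apply: allpairs_uniq => // -[a b] [c d] _ _ /= [-> ->]. Qed.

Lemma mem_pairs (S T : eqType) (s : seq S) (t : seq T) (p : S * T) :
  (p \in [seq (a, b) | a <- s, b <- t]) = (p.1 \in s) && (p.2 \in t).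
Proof.
apply/allpairsP/idP => [[[a b] /= [sa tb ->]]|]; first by rewrite sa tb.
by case: p => a b /= /andP[sa tb]; exists (a, b).
Qed.

Lemma quads_uniq n : uniq (quads n).
Proof.
have ur := iota_uniq 1 n; have urr := pairs_uniq ur ur.
by apply: filter_uniq; apply: pairs_uniq.
Qed.

Lemma mem_quads n (a b x y : nat) : (((a, b), (x, y)) \in quads n) =
  [&& 0 < a, 0 < b, 0 < x, 0 < y & a * x + b * y == n]%N.
Proof.
rewrite mem_filter !mem_pairs /= !mem_iota; apply/idP/idP.
  by case/and3P => -> /andP[/andP[-> _] /andP[-> _]] /andP[/andP[-> _] /andP[-> _]].
by case/and5P => a0 b0 x0 y0 /eqP <-; rewrite eqxx a0 b0 x0 y0 /=; nia.
Qed.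

Lemma big_quads (R : nmodType) n (P P' : pred ((nat * nat) * (nat * nat))) h h'
    (F : (nat * nat) * (nat * nat) -> R) :
    {in quads n, forall q, P q -> [/\ h q \in quads n, P' (h q) & h' (h q) = q]} ->
    {in quads n, forall q, P' q -> [/\ h' q \in quads n, P (h' q) & h (h' q) = q]} ->
  \sum_(q <- quads n | P' q) F q = \sum_(q <- quads n | P q) F (h q).
Proof.
move=> hP h'P; rewrite -big_filter -[RHS]big_filter.
have uq p := filter_uniq p (quads_uniq n).
apply: (@big_bij _ _ _ _ _ h h') => // q.
  rewrite mem_filter => /andP[Pq qQ]; have [hq Phq ->] := hP _ qQ Pq.
  by rewrite mem_filter Phq.
rewrite mem_filter => /andP[Pq qQ]; have [hq Phq ->] := h'P _ qQ Pq.
by rewrite mem_filter Phq.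
Qed.

Notation qa q := (q.1.1) (only parsing).
Notation qb q := (q.1.2) (only parsing).
Notation qx q := (q.2.1) (only parsing).
Notation qy q := (q.2.2) (only parsing).

(** By (a + b) x + b (y - x) = a x + b y, quadruples with x < y correspond to
    quadruples with b < a. *)
Lemma quads_shear (R : nmodType) n (F : (nat * nat) * (nat * nat) -> R) :
  \sum_(q <- quads n | (qb q < qa q)%N) F q =
  \sum_(q <- quads n | (qx q < qy q)%N)
    F ((qa q + qb q, qb q), (qx q, qy q - qx q))%N.
Proof.
apply: (big_quads (h' := fun q => ((qa q - qb q, qb q), (qx q, qx q + qy q))%N)).
  case=> [[a b] [x y]]; rewrite !mem_quads /= => /and5P[a0 b0 x0 y0 /eqP e] lt.
  by split; [nia | rewrite /=; lia | do 2!congr pair; lia].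
case=> [[a b] [x y]]; rewrite !mem_quads /= => /and5P[a0 b0 x0 y0 /eqP e] lt.
by split; [nia | rewrite /=; lia | do 2!congr pair; lia].
Qed.

Lemma quads_swap (R : nmodType) n P (F : (nat * nat) * (nat * nat) -> R) :
  \sum_(q <- quads n | P q) F q =
  \sum_(q <- quads n | P ((qb q, qa q), (qy q, qx q)))
    F ((qb q, qa q), (qy q, qx q)).
Proof.
apply: (big_quads (h' := fun q => ((qb q, qa q), (qy q, qx q)))) => -[[a b] [x y]];
  by rewrite !mem_quads /= addnC => /and5P[-> -> -> -> ->] ?.
Qed.

Lemma quads_exchange (R : nmodType) n P (F : (nat * nat) * (nat * nat) -> R) :
  \sum_(q <- quads n | P q) F q =
  \sum_(q <- quads n | P (q.2, q.1)) F (q.2, q.1).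
Proof.
apply: (big_quads (h' := fun q => (q.2, q.1))) => -[[a b] [x y]];
  rewrite !mem_quads /= [(x * a)%N]mulnC [(y * b)%N]mulnC;
  by move=> /and5P[-> -> -> -> ->] ?.
Qed.

(** On x = y the equation is (a + b) x = n: a divisor d = a + b of n, and a < d. *)
Lemma quads_diag (R : nmodType) n (F : nat -> nat -> nat -> R) :
  \sum_(q <- quads n | qx q == qy q) F (qa q) (qb q) (qx q) =
  \sum_(d <- divs n) \sum_(a <- iota 1 d.-1) F a (d - a)%N (n %/ d)%N.
Proof.
transitivity (\sum_(p <- [seq (d, a) | d <- divs n, a <- iota 1 d.-1])
    F p.2 (p.1 - p.2)%N (n %/ p.1)%N); last by rewrite big_allpairs_dep.
rewrite -big_filter.
pose h' (p : nat * nat) := ((p.2, p.1 - p.2), (n %/ p.1, n %/ p.1))%N.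
pose h (q : (nat * nat) * (nat * nat)) := (qa q + qb q, qa q)%N.
apply: (@big_bij _ _ _ _ _ h' h).
- apply: allpairs_uniq_dep; first exact: divs_uniq.
    by move=> d _; apply: iota_uniq.
  by move=> [i p] [j r] _ _ /= [-> ->].
- exact/filter_uniq/quads_uniq.
- move=> _ /allpairsPdep[d [a [+ + ->]]]; rewrite mem_divs mem_iota /h' /h /=.
  case/andP=> n0 dn /andP[a0 ad]; have d0 := dvdn_gt0 n0 dn.
  have ad' : (a < d)%N by lia.
  have x0 : (0 < n %/ d)%N by rewrite divn_gt0 // dvdn_leq.
  split; last by congr pair; lia.
  rewrite mem_filter mem_quads a0 x0 subn_gt0 ad' -mulnDl subnKC 1?ltnW //.
  by rewrite [(d * _)%N]mulnC divnK // !eqxx.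
- case=> [[a b] [x y]]; rewrite mem_filter mem_quads /= => /andP[/eqP exy].
  rewrite -exy => /and5P[a0 b0 x0 _ /eqP e]; rewrite -mulnDl in e.
  rewrite /h' /h /= -e addKn mulKn ?addn_gt0 ?a0 //; split => //.
  apply/allpairsPdep; exists (a + b)%N, a; split => //.
    by rewrite mem_divs dvdn_mulr // muln_gt0 x0 addn_gt0 a0.
  by rewrite mem_iota; lia.
Qed.

Lemma lambertM (R : comNzRingType) (u v : nat -> R) n :
  (lambert u * lambert v) n = \sum_(q <- quads n) u (qa q) * v (qb q).
Proof.
transitivity (\sum_(i <- iota 0 n.+1)
    \sum_(p <- [seq (a, b) | a <- divs i, b <- divs (n - i)]) u p.1 * v p.2).
  rewrite fpsM -(big_mkord predT (fun i => lambert u i * lambert v (n - i)%N)).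
  rewrite /index_iota subn0; apply: eq_bigr => i _.
  rewrite big_allpairs /= mulr_suml; apply: eq_bigr => a _.
  by rewrite mulr_sumr.
transitivity (\sum_(ip <- [seq (i, p) | i <- iota 0 n.+1,
    p <- [seq (a, b) | a <- divs i, b <- divs (n - i)]]) u ip.2.1 * v ip.2.2).
  by rewrite big_allpairs_dep.
pose h' (ip : nat * (nat * nat)) :=
  (ip.2, (ip.1 %/ ip.2.1, (n - ip.1) %/ ip.2.2))%N.
apply: (@big_bij _ _ _ _ _ (fun q => (qa q * qx q, q.1))%N h').
- exact: quads_uniq.
- apply: allpairs_uniq_dep; first exact: iota_uniq.
    by move=> i _; apply: pairs_uniq; apply: divs_uniq.
  by move=> [i p] [j r] _ _ /= [-> ->].
- case=> [[a b] [x y]]; rewrite mem_quads => /and5P[a0 b0 x0 y0 /eqP e]; split.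
    apply/allpairsPdep; exists (a * x)%N, (a, b); split => //.
      by rewrite mem_iota; lia.
    rewrite mem_pairs !mem_divs /= dvdn_mulr // -e addKn dvdn_mulr //.
    by rewrite !muln_gt0 a0 b0 x0 y0.
  by rewrite /h' /= -e addKn !mulKn.
- move=> _ /allpairsPdep[i [[a b] [i_n + ->]]].
  rewrite mem_pairs !mem_divs /= => /andP[/andP[i0 ai] /andP[ni0 bi]].
  rewrite /h' /= mem_quads; split; last by rewrite mulnC divnK.
  have le_in : (i <= n)%N by rewrite mem_iota in i_n; lia.
  rewrite !divn_gt0 ?(dvdn_gt0 i0 ai) ?(dvdn_gt0 ni0 bi) //.
  by rewrite (dvdn_leq i0 ai) (dvdn_leq ni0 bi) [(a * _)%N]mulnC [(b * _)%N]mulnC !divnK // subnKC // eqxx.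
Qed.

(** The shear turns the sum of g(a - b) over a > b into the sum of g(a) over x < y,
    and the sum of g(a + b) over x < y into the sum of g(a) over a > b; exchanging
    (a, x) with (b, y) doubles both. The sums of g(a) over x < y and over a > b
    differ only by diagonal terms, because the shear conjugated by that exchange
    preserves a. The diagonals are sums over divisors. *)
Lemma liouville (n : nat) (g : nat -> int) :
  \sum_(q <- quads n) (g (`|qa q - qb q|)%N - g (qa q + qb q)%N) =
  \sum_(d <- divs n) (2 * (((n %/ d).-1)%:R * g d) + (d.-1)%:R * (g 0%N - g d)
                      - 2 * \sum_(a <- iota 1 d.-1) g a).
Proof.
pose S P F : int := \sum_(q <- quads n | P q) F q.
have Ssplit P F : S predT F = S P F + S (fun q => ~~ P q) F.
  exact: bigID.
pose gtab (q : (nat * nat) * (nat * nat)) := (qb q < qa q)%N.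
pose ltab (q : (nat * nat) * (nat * nat)) := (qa q < qb q)%N.
pose eqab (q : (nat * nat) * (nat * nat)) := (qa q == qb q).
pose gtxy (q : (nat * nat) * (nat * nat)) := (qy q < qx q)%N.
pose ltxy (q : (nat * nat) * (nat * nat)) := (qx q < qy q)%N.
pose eqxy (q : (nat * nat) * (nat * nat)) := (qx q == qy q).
have tri_ab F : S predT F = S eqab F + S gtab F + S ltab F.
  rewrite (Ssplit eqab) -addrA; congr (_ + _).
  rewrite /S (bigID gtab) /=; congr (_ + _); apply: eq_bigl => q;
    by rewrite /eqab /gtab /ltab; lia.
have tri_xy F : S predT F = S eqxy F + S gtxy F + S ltxy F.
  rewrite (Ssplit eqxy) -addrA; congr (_ + _).
  rewrite /S (bigID gtxy) /=; congr (_ + _); apply: eq_bigl => q;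
    by rewrite /eqxy /gtxy /ltxy; lia.
have diff_gt : S gtab (fun q => g `|qa q - qb q|%N) = S ltxy (fun q => g (qa q)).
  rewrite [LHS]quads_shear; apply: eq_bigr => q _; congr g => /=; lia.
have diff_lt : S ltab (fun q => g `|qa q - qb q|%N) = S ltxy (fun q => g (qa q)).
  by rewrite -diff_gt [LHS]quads_swap; apply: eq_bigr => q _; rewrite distnC.
have sum_gt : S ltxy (fun q => g (qa q + qb q)%N) = S gtab (fun q => g (qa q)).
  by rewrite [RHS]quads_shear.
have sum_lt : S gtxy (fun q => g (qa q + qb q)%N) = S gtab (fun q => g (qa q)).
  by rewrite -sum_gt [LHS]quads_swap; apply: eq_bigr => q _; rewrite addnC.
have keep_a : S gtxy (fun q => g (qa q)) = S ltab (fun q => g (qa q)).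
  rewrite [LHS]quads_swap [RHS]quads_swap; symmetry.
  exact: (quads_shear n (fun q => g (qb q))).
have eqd : S eqab (fun q => g `|qa q - qb q|%N) = \sum_(d <- divs n) (d.-1)%:R * g 0%N.
  transitivity (S eqab (fun=> g 0%N)).
    by apply: eq_bigr => q /eqP ->; rewrite distnn.
  rewrite /S quads_exchange (quads_diag n (fun _ _ _ => g 0%N)).
  by apply: eq_bigr => d _; rewrite big_const_seq count_predT size_iota iter_addr_0 mulr_natl.
have eqg : S eqab (fun q => g (qa q)) = \sum_(d <- divs n) ((n %/ d).-1)%:R * g d.
  rewrite /S quads_exchange (quads_diag n (fun _ _ x => g x)).
  rewrite -(divs_codiv n (fun d => ((n %/ d).-1)%:R * g d)).
  apply: eq_big_seq => d; rewrite mem_divs => /andP[n0 dn].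
  by rewrite big_const_seq count_predT size_iota iter_addr_0 mulr_natl divnA // mulKn.
have exg : S eqxy (fun q => g (qa q)) = \sum_(d <- divs n) \sum_(a <- iota 1 d.-1) g a.
  exact: (quads_diag n (fun a _ _ => g a)).
have exs : S eqxy (fun q => g (qa q + qb q)%N) = \sum_(d <- divs n) (d.-1)%:R * g d.
  rewrite /S (quads_diag n (fun a b _ => g (a + b)%N)); apply: eq_bigr => d _.
  rewrite (eq_big_seq (fun=> g d)).
    by rewrite big_const_seq count_predT size_iota iter_addr_0 mulr_natl.
  by move=> a; rewrite mem_iota => ?; congr g; lia.
rewrite big_split sumrN /= -/(S predT (fun q => g `|qa q - qb q|%N)).
rewrite -/(S predT (fun q => g (qa q + qb q)%N)) tri_ab (tri_xy (fun q => g (_ + _)%N)).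
rewrite diff_gt diff_lt sum_gt sum_lt eqd exs.
have := tri_ab (fun q => g (qa q)); rewrite (tri_xy (fun q => g (qa q))) keep_a eqg exg.
move: (S ltxy _) (S ltab _) (S gtab _) => u v w e.
have {e} -> : u = \sum_(d <- divs n) ((n %/ d).-1)%:R * g d + w
   - \sum_(d <- divs n) \sum_(a <- iota 1 d.-1) g a by move: e; lia.
rewrite [RHS](eq_bigr (fun d => (d.-1)%:R * g 0%N - (d.-1)%:R * g d
  + 2 * (((n %/ d).-1)%:R * g d) - 2 * \sum_(a <- iota 1 d.-1) g a)); last first.
  by move=> d _; ring.
rewrite !(big_split, sumrN) /= -!mulr_sumr; ring.
Qed.

(** * Convolutions of divisor sums *)

Definition sigma (k : nat) : fps int := lambert (fun d => d%:R ^+ k).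
Definition altsigma (k : nat) : fps int := lambert (fun d => (-1) ^+ d * d%:R ^+ k).

Lemma lambert_dq (R : comNzRingType) (u : nat -> R) n :
  dq (lambert u) n = \sum_(d <- divs n) n%:R * u d.
Proof. by rewrite -mulr_sumr mulr_natl. Qed.

Lemma sum_iotaS (F : nat -> int) m :
  \sum_(a <- iota 1 m.+1) F a = \sum_(a <- iota 1 m) F a + F m.+1.
Proof. by rewrite -(addn1 m) iotaD big_cat /= big_seq1 add1n addn1. Qed.

(** If g(|a - b|) - g(a + b) splits as a symmetrized product of u and v, the
    identity of Liouville evaluates the product of their Lambert series. The factor
    e clears the denominator of the closed form for the sums of g, and t n d is the
    resulting contribution of the divisor d of n = k d. *)
Lemma liouville_conv (g u v : nat -> int) (c e : int) (t : nat -> nat -> int) :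
    (forall a b : nat, g `|a - b|%N - g (a + b)%N = - c * (u a * v b + u b * v a)) ->
    (forall k m, t (k.+1 * m.+1)%N m.+1 =
       e * (2 * (k%:R * g m.+1) + m%:R * (g 0%N - g m.+1)
        - 2 * \sum_(a <- iota 1 m) g a)) ->
  forall n, - 2 * e * c * (lambert u * lambert v) n = \sum_(d <- divs n) t n d.
Proof.
move=> hg ht n; have := liouville n g.
rewrite (eq_bigr (fun q => - c * (u q.1.1 * v q.1.2 + u q.1.2 * v q.1.1))); last first.
  by move=> q _; rewrite hg.
rewrite -mulr_sumr big_split -lambertM.
have -> : \sum_(q <- quads n) u q.1.2 * v q.1.1 = (lambert u * lambert v) n.
  by rewrite mulrC lambertM; apply: eq_bigr => q _; rewrite mulrC.
move: ((lambert u * lambert v) n) => z /(congr1 ( *%R e)) eq_n.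
have -> : -2 * e * c * z = e * (- c * (z + z)) by ring.
rewrite eq_n mulr_sumr; apply: eq_big_seq => d dn.
move: dn; rewrite mem_divs => /andP[n0 /dvdnP[k n_eq]].
move: n0; rewrite {}n_eq; case: k d => [|k] [|m]; rewrite ?mul0n ?muln0 // mulnK // ht.
Qed.

Lemma sum_sqr m : 6 * \sum_(a <- iota 1 m) (a%:R : int) ^+ 2 =
  m%:R * (m%:R + 1) * (2 * m%:R + 1).
Proof.
by elim: m => [|m IHm]; rewrite ?big_nil // sum_iotaS mulrDr IHm -natr1; ring.
Qed.

Lemma sum_pow4 m : 30 * \sum_(a <- iota 1 m) (a%:R : int) ^+ 4 =
  6 * m.+1%:R ^+ 5 - 15 * m.+1%:R ^+ 4 + 10 * m.+1%:R ^+ 3 - m.+1%:R.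
Proof.
elim: m => [|m IHm]; first by rewrite big_nil.
by rewrite sum_iotaS mulrDr IHm -[m.+2%:R]natr1; ring.
Qed.

Lemma sum_altsqr m : 2 * \sum_(a <- iota 1 m) ((-1) ^+ a * (a%:R : int) ^+ 2) =
  - (-1) ^+ m.+1 * m.+1%:R * m%:R.
Proof.
elim: m => [|m IHm]; first by rewrite big_nil mulr0.
by rewrite sum_iotaS mulrDr IHm -[m.+2%:R]natr1 -[m.+1%:R]natr1 !exprS; ring.
Qed.

Lemma sum_altpow4 m : 2 * \sum_(a <- iota 1 m) ((-1) ^+ a * (a%:R : int) ^+ 4) =
  - (-1) ^+ m.+1 * (m.+1%:R ^+ 4 - 2 * m.+1%:R ^+ 3 + m.+1%:R).
Proof.
elim: m => [|m IHm]; first by rewrite big_nil mulr0.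
by rewrite sum_iotaS mulrDr IHm -[m.+2%:R]natr1 !exprS; ring.
Qed.

Lemma even_distn (h : int -> int) (a b : nat) :
  (forall x, h (- x) = h x) -> h (`|a - b|%N)%:Z = h (a%:Z - b%:Z).
Proof.
move=> he; case: (leqP b a) => [ba|/ltnW ab].
  by rewrite distnEl // -subzn.
by rewrite distnEr // -subzn // -opprB he.
Qed.

Lemma sign_distn (a b : nat) : (-1) ^+ `|a - b|%N = (-1) ^+ (a + b)%N :> int.
Proof.
have [ba|/ltnW ab] := leqP b a.
  by rewrite distnEl // -{2}(subnK ba) -addnA addnn exprD -mul2n exprM sqrrN !expr1n mulr1.
by rewrite distnEr // -{2}(subnK ab) addnC -addnA addnn exprD -mul2n exprM sqrrN !expr1n mulr1.
Qed.

(** The choices of g that follow are n^2, n^4 and the same with the sign (-1)^n; the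
    sign brings in the divisor sums of q^2. *)
Lemma sigma1_sqr : 12 * sigma 1 ^+ 2 = 5 * sigma 3 - 6 * dq (sigma 1) + sigma 1.
Proof.
apply: fpsP => n; rewrite !(fpsD, fpsN) !fps_natM lambert_dq expr2.
pose t (n d : nat) : int := 5 * d%:R ^+ 3 - 6 * (n%:R * d%:R ^+ 1) + d%:R ^+ 1.
rewrite (_ : 12 = - 2 * (-3) * 2) // (@liouville_conv (fun a => a%:R ^+ 2) _ _ _ _ t).
- by rewrite !mulr_sumr -sumrN -!big_split.
- move=> a b; rewrite !natz (even_distn (h := fun x => x ^+ 2)) ?PoszD //=; last exact: sqrrN.
  ring.
- move=> k m; rewrite /t.
  transitivity (-3 * (2 * (k%:R * m.+1%:R ^+ 2) + m%:R * (0 ^+ 2 - m.+1%:R ^+ 2)) +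
     6 * \sum_(a <- iota 1 m) (a%:R : int) ^+ 2); last by ring.
  by rewrite sum_sqr natrM -!natr1; ring.
Qed.

Lemma sigma1_sigma3 : 240 * (sigma 1 * sigma 3) =
  21 * sigma 5 - 30 * dq (sigma 3) + 10 * sigma 3 - sigma 1.
Proof.
apply: fpsP => n; rewrite !(fpsD, fpsN) !fps_natM lambert_dq.
pose t (n d : nat) : int :=
  21 * d%:R ^+ 5 - 30 * (n%:R * d%:R ^+ 3) + 10 * d%:R ^+ 3 - d%:R ^+ 1.
rewrite (_ : 240 = - 2 * (-15) * 8) // (@liouville_conv (fun a => a%:R ^+ 4) _ _ _ _ t).
- by rewrite !mulr_sumr -!sumrN -!big_split.
- move=> a b; rewrite !natz (even_distn (h := fun x => x ^+ 4)) ?PoszD //=.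
    ring.
  by move=> x; ring.
- move=> k m; rewrite /t.
  transitivity (-15 * (2 * (k%:R * m.+1%:R ^+ 4) + m%:R * (0 ^+ 4 - m.+1%:R ^+ 4)) +
     30 * \sum_(a <- iota 1 m) (a%:R : int) ^+ 4); last by ring.
  by rewrite sum_pow4 natrM -!natr1; ring.
Qed.

Lemma altsigma1_sqr :
  4 * altsigma 1 ^+ 2 = altsigma 3 - 2 * dq (altsigma 1) + altsigma 1.
Proof.
apply: fpsP => n; rewrite !(fpsD, fpsN) !fps_natM lambert_dq expr2.
pose t (n d : nat) : int := (-1) ^+ d * d%:R ^+ 3
  - 2 * (n%:R * ((-1) ^+ d * d%:R ^+ 1)) + (-1) ^+ d * d%:R ^+ 1.
rewrite (_ : 4 = - 2 * (-1) * 2) //.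
rewrite (@liouville_conv (fun a => (-1) ^+ a * a%:R ^+ 2) _ _ _ _ t).
- by rewrite !mulr_sumr -sumrN -!big_split.
- move=> a b; rewrite sign_distn !natz (even_distn (h := fun x => x ^+ 2));
    last exact: sqrrN.
  by rewrite PoszD /= exprD; ring.
- move=> k m; rewrite /t.
  transitivity (- (2 * (k%:R * ((-1) ^+ m.+1 * m.+1%:R ^+ 2))
      + m%:R * (0 - ((-1) ^+ m.+1 * m.+1%:R ^+ 2)))
     + 2 * \sum_(a <- iota 1 m) ((-1) ^+ a * (a%:R : int) ^+ 2)); last by ring.
  by rewrite sum_altsqr natrM -!natr1; move: ((-1) ^+ _) => z; ring.
Qed.

Lemma altsigma1_altsigma3 : 16 * (altsigma 1 * altsigma 3) =
  altsigma 5 - 2 * dq (altsigma 3) + 2 * altsigma 3 - altsigma 1.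
Proof.
apply: fpsP => n; rewrite !(fpsD, fpsN) !fps_natM lambert_dq.
pose t (n d : nat) : int := (-1) ^+ d * d%:R ^+ 5
  - 2 * (n%:R * ((-1) ^+ d * d%:R ^+ 3)) + 2 * ((-1) ^+ d * d%:R ^+ 3)
  - (-1) ^+ d * d%:R ^+ 1.
rewrite (_ : 16 = - 2 * (-1) * 8) //.
rewrite (@liouville_conv (fun a => (-1) ^+ a * a%:R ^+ 4) _ _ _ _ t).
- by rewrite !mulr_sumr -!sumrN -!big_split.
- move=> a b; rewrite sign_distn !natz (even_distn (h := fun x => x ^+ 4)).
    by rewrite PoszD /= exprD; ring.
  by move=> x; ring.
- move=> k m; rewrite /t.
  transitivity (- (2 * (k%:R * ((-1) ^+ m.+1 * m.+1%:R ^+ 4))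
      + m%:R * (0 - ((-1) ^+ m.+1 * m.+1%:R ^+ 4)))
     + 2 * \sum_(a <- iota 1 m) ((-1) ^+ a * (a%:R : int) ^+ 4)); last by ring.
  by rewrite sum_altpow4 natrM -!natr1; move: ((-1) ^+ _) => z; ring.
Qed.

(** The sign is 1 exactly on the even divisors, which are twice those of n / 2. *)
Lemma altsigmaE k : altsigma k = (2 ^ k.+1)%:R * vq 2 (sigma k) - sigma k.
Proof.
apply: fpsP => n; rewrite fpsB fps_natM vqE /=.
transitivity (2 * \sum_(d <- divs n | ~~ odd d) (d%:R : int) ^+ k
   - \sum_(d <- divs n) (d%:R : int) ^+ k).
  rewrite [X in _ - X](bigID odd) /= [LHS](bigID odd) /=.
  rewrite (eq_bigr (fun d => - (d%:R ^+ k))); last first.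
    by move=> d od; rewrite -signr_odd od expr1 mulN1r.
  rewrite sumrN [X in _ + X = _](eq_bigr (fun d => d%:R ^+ k)); last first.
    by move=> d od; rewrite -signr_odd (negPf od) mul1r.
  by ring.
congr (_ - _); rewrite expnS natrM -mulrA; congr (_ * _).
case: ifP => [/dvdnP[m ->]|ndiv].
  rewrite mulnK // mulr_sumr -big_filter.
  rewrite (@big_bij _ _ _ (divs m) _ (fun d => d * 2)%N (fun d => d %/ 2)%N).
  - by apply: eq_bigr => d _; rewrite natrM exprMn natrX mulrC.
  - exact: divs_uniq.
  - by rewrite filter_uniq // divs_uniq.
  - move=> d; rewrite mem_divs => /andP[m0 dm]; rewrite mulnK // mem_filter.
    by rewrite mem_divs muln_gt0 m0 dvdn_pmul2r // dm muln2 odd_double.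
  - move=> d; rewrite mem_filter mem_divs -dvdn2 muln_gt0 andbT.
    by move=> /and3P[/dvdnP[e ->] m0]; rewrite mulnK // dvdn_pmul2r // mem_divs m0.
rewrite mulr0 -big_filter big1_seq // => d; rewrite mem_filter mem_divs -dvdn2.
by move=> /andP[_ /and3P[/dvdn_trans d2 _ /d2]]; rewrite ndiv.
Qed.

(** * Differential equations of level 2 *)

(** P, Q, R are the Eisenstein series of weight 2, 4, 6, and A is the modular form of
    weight 2 for Gamma_0(2). X and Y are the two eta quotients of weight 4 and level
    2; their product formulas are [eisX_euler] and [eisY_euler]. *)
Definition eisP : fps int := 1 - 24 * sigma 1.
Definition eisQ : fps int := 1 + 240 * sigma 3.
Definition eisR : fps int := 1 - 504 * sigma 5.
Definition eisA : fps int := 2 * vq 2 eisP - eisP.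
Definition eisY : fps int := sigma 3 - vq 2 (sigma 3).
Definition eisX : fps int := eisA ^+ 2 - 64 * eisY.

Lemma fps_int_eq (c : nat) (f g : fps int) :
  (0 < c)%N -> c%:R * (f - g) = 0 -> f = g.
Proof.
move=> c0 e; apply: fpsP => n; have : (c%:R * (f - g)) n = (0 : fps int) n by rewrite e.
rewrite fps_natM fpsB fps0E => /eqP; rewrite mulf_eq0 subr_eq0 pnatr_eq0.
by case: c c0 {e} => // c _ /eqP.
Qed.

Section LinearAlgebra.
Context (K : comNzRingType) (S1 S3 S5 V1 V3 V5 dS1 dS3 dV1 dV3 : K).
Let b1 := 4 * V1 - S1.
Let b3 := 16 * V3 - S3.
Let A := 1 - 48 * V1 + 24 * S1.
Let P := 1 - 24 * S1.
Let Y := S3 - V3.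
Let A2 := 1 + 48 * S3 + 192 * V3.

(** S_k and V_k stand for the generating functions of sigma_k in q and in q^2. The
    convolution identities are linear in the products of the S and V, and the
    multipliers in the proofs solve the resulting linear systems. *)
Hypotheses
  (f1 : 12 * S1 ^+ 2 = 5 * S3 - 6 * dS1 + S1)
  (f2 : 12 * V1 ^+ 2 = 5 * V3 - 3 * dV1 + V1)
  (f3 : 4 * b1 ^+ 2 = b3 - 2 * (4 * dV1 - dS1) + b1).

Lemma weight4_A : A ^+ 2 = A2.
Proof.
apply/eqP; rewrite -subr_eq0; apply/eqP.
transitivity (24 * (12 * S1 ^+ 2 - (5 * S3 - 6 * dS1 + S1))
  - 192 * (12 * V1 ^+ 2 - (5 * V3 - 3 * dV1 + V1))
  + 72 * (4 * b1 ^+ 2 - (b3 - 2 * (4 * dV1 - dS1) + b1))).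
  by rewrite /A /A2 /b1 /b3; ring.
by rewrite f1 f2 f3; ring.
Qed.

Lemma weight4_dA : 6 * (24 * dS1 - 48 * dV1) = A * P - A2 + 192 * Y.
Proof.
apply/eqP; rewrite -subr_eq0; apply/eqP.
transitivity (36 * (12 * S1 ^+ 2 - (5 * S3 - 6 * dS1 + S1))
  - 192 * (12 * V1 ^+ 2 - (5 * V3 - 3 * dV1 + V1))
  + 36 * (4 * b1 ^+ 2 - (b3 - 2 * (4 * dV1 - dS1) + b1))).
  by rewrite /A /A2 /P /Y /b1 /b3; ring.
by rewrite f1 f2 f3; ring.
Qed.

Hypotheses
  (f4 : 240 * (S1 * S3) = 21 * S5 - 30 * dS3 + 10 * S3 - S1)
  (f5 : 240 * (V1 * V3) = 21 * V5 - 15 * dV3 + 10 * V3 - V1)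
  (f6 : 16 * (b1 * b3) = 64 * V5 - S5 - 2 * (16 * dV3 - dS3) + 2 * b3 - b1)
  (f7 : 3 * (48 * dS3 + 192 * dV3) = (P - A) * A2 + 192 * A * Y).

Let combination (x y z t : K) :=
  x * (240 * (S1 * S3) - (21 * S5 - 30 * dS3 + 10 * S3 - S1))
  + y * (240 * (V1 * V3) - (21 * V5 - 15 * dV3 + 10 * V3 - V1))
  + z * (16 * (b1 * b3) - (64 * V5 - S5 - 2 * (16 * dV3 - dS3) + 2 * b3 - b1))
  + t * (3 * (48 * dS3 + 192 * dV3) - ((P - A) * A2 + 192 * A * Y)).

Let combination0 x y z t : combination x y z t = 0.
Proof. by rewrite /combination f4 f5 f6 f7; ring. Qed.

Lemma weight6_dY : 192 * (3 * (dS3 - dV3) - Y * (2 * A + P)) = 0.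
Proof.
rewrite -(combination0 12 (- 768) 252 5) /combination /A /A2 /P /Y /b1 /b3; ring.
Qed.

Lemma weight6_R : 1 - 504 * S5 = A * A2 - 576 * A * Y.
Proof.
apply/eqP; rewrite -subr_eq0 -(combination0 12 768 (- 252) (- 6)); apply/eqP.
by rewrite /combination /A /A2 /P /Y /b1 /b3; ring.
Qed.

Lemma weight6_V5 : 576 * (V5 - (S5 - A * Y)) = 0.
Proof.
rewrite -(combination0 12 960 (- 324) (- 7)) /combination /A /A2 /P /Y /b1 /b3; ring.
Qed.

End LinearAlgebra.

Lemma altsigma1_sqr_sigma (b1 := 4 * vq 2 (sigma 1) - sigma 1) :
  4 * b1 ^+ 2 = 16 * vq 2 (sigma 3) - sigma 3
    - 2 * (4 * dq (vq 2 (sigma 1)) - dq (sigma 1)) + b1.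
Proof.
have e1 : altsigma 1 = 4 * vq 2 (sigma 1) - sigma 1 := altsigmaE 1.
have e3 : altsigma 3 = 16 * vq 2 (sigma 3) - sigma 3 := altsigmaE 3.
by have := altsigma1_sqr; rewrite e1 e3 dqB dq_natM.
Qed.

Lemma altsigma1_altsigma3_sigma (b1 := 4 * vq 2 (sigma 1) - sigma 1)
    (b3 := 16 * vq 2 (sigma 3) - sigma 3) :
  16 * (b1 * b3) = 64 * vq 2 (sigma 5) - sigma 5
    - 2 * (16 * dq (vq 2 (sigma 3)) - dq (sigma 3)) + 2 * b3 - b1.
Proof.
have e1 : altsigma 1 = 4 * vq 2 (sigma 1) - sigma 1 := altsigmaE 1.
have e3 : altsigma 3 = 16 * vq 2 (sigma 3) - sigma 3 := altsigmaE 3.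
have e5 : altsigma 5 = 64 * vq 2 (sigma 5) - sigma 5 := altsigmaE 5.
by have := altsigma1_altsigma3; rewrite e1 e3 e5 dqB dq_natM.
Qed.


Lemma eisAE : eisA = 1 - 48 * vq 2 (sigma 1) + 24 * sigma 1.
Proof. by rewrite /eisA /eisP vqB vq1 vq_natM; ring. Qed.

Lemma vq2_sigma1_sqr : 12 * vq 2 (sigma 1) ^+ 2 =
  5 * vq 2 (sigma 3) - 3 * dq (vq 2 (sigma 1)) + vq 2 (sigma 1).
Proof.
have lin (x y z : fps int) : vq 2 (5 * x - 6 * y + z) =
    5 * vq 2 x - 6 * vq 2 y + vq 2 z by rewrite vqD vqB !vq_natM.
transitivity (vq 2 (12 * sigma 1 ^+ 2)); first by rewrite vq_natM vqX.
have dq_lin (y : fps int) : 3 * dq (vq 2 y) = 6 * vq 2 (dq y).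
  by rewrite dq_vq; ring.
apply: etrans (etrans (congr1 _ sigma1_sqr) (lin _ _ _)) _.
by congr (_ - _ + _); apply/esym/dq_lin.
Qed.

Lemma vq2_sigma1_sigma3 : 240 * (vq 2 (sigma 1) * vq 2 (sigma 3)) =
  21 * vq 2 (sigma 5) - 15 * dq (vq 2 (sigma 3)) + 10 * vq 2 (sigma 3) - vq 2 (sigma 1).
Proof.
have lin (x y z t : fps int) : vq 2 (21 * x - 30 * y + 10 * z - t) =
    21 * vq 2 x - 30 * vq 2 y + 10 * vq 2 z - vq 2 t.
  by rewrite vqB vqD vqB !vq_natM.
transitivity (vq 2 (240 * (sigma 1 * sigma 3))); first by rewrite vq_natM vqM.
have dq_lin (y : fps int) : 15 * dq (vq 2 y) = 30 * vq 2 (dq y).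
  by rewrite dq_vq; ring.
apply: etrans (etrans (congr1 _ sigma1_sigma3) (lin _ _ _ _)) _.
by congr (_ - _ + _ - _); apply/esym/dq_lin.
Qed.

Lemma eisA_sqr : eisA ^+ 2 = 1 + 48 * sigma 3 + 192 * vq 2 (sigma 3).
Proof.
rewrite eisAE.
exact: weight4_A sigma1_sqr vq2_sigma1_sqr altsigma1_sqr_sigma.
Qed.

Lemma eisQE : eisQ = eisA ^+ 2 + 192 * eisY.
Proof. by rewrite eisA_sqr /eisQ /eisY; ring. Qed.

Lemma dq_eisA : 6 * dq eisA = eisA * eisP - eisA ^+ 2 + 192 * eisY.
Proof.
rewrite eisA_sqr eisAE dqD dqB dq1 !dq_natM sub0r [- _ + _]addrC.
exact: weight4_dA sigma1_sqr vq2_sigma1_sqr altsigma1_sqr_sigma.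
Qed.

(** The convolutions give three relations between the four products of sigma_1 and
    sigma_3, each taken in q or in q^2; differentiating the formula for the square
    of A gives a fourth. *)
Lemma dq_eisA_sqr : 3 * (48 * dq (sigma 3) + 192 * dq (vq 2 (sigma 3))) =
  (eisP - eisA) * (1 + 48 * sigma 3 + 192 * vq 2 (sigma 3)) + 192 * eisA * eisY.
Proof.
transitivity (3 * dq (eisA ^+ 2)).
  by rewrite eisA_sqr dqD dqD dq1 !dq_natM add0r.
rewrite -eisA_sqr dqX expr1.
have alg (K : comNzRingType) (A P Y dA : K) :
    6 * dA = A * P - A ^+ 2 + 192 * Y ->
    3 * (2%:R * A * dA) = (P - A) * A ^+ 2 + 192 * A * Y.
  by move=> h; transitivity (A * (6 * dA)); [|rewrite h]; ring.
exact: alg dq_eisA.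
Qed.

Lemma dq_eisY : 3 * dq eisY = eisY * (2 * eisA + eisP).
Proof.
have f7 := dq_eisA_sqr; rewrite eisAE in f7.
apply: (@fps_int_eq 192) => //; rewrite eisAE dqB.
exact: weight6_dY sigma1_sigma3 vq2_sigma1_sigma3 altsigma1_altsigma3_sigma f7.
Qed.

Lemma eisRE : eisR = eisA ^+ 3 - 576 * eisA * eisY.
Proof.
have f7 := dq_eisA_sqr; rewrite exprS eisA_sqr; rewrite !eisAE in f7 *.
exact: weight6_R sigma1_sigma3 vq2_sigma1_sigma3 altsigma1_altsigma3_sigma f7.
Qed.

Lemma vq2_sigma5 : vq 2 (sigma 5) = sigma 5 - eisA * eisY.
Proof.
have f7 := dq_eisA_sqr; apply: (@fps_int_eq 576) => //; rewrite !eisAE in f7 *.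
exact: weight6_V5 sigma1_sigma3 vq2_sigma1_sigma3 altsigma1_altsigma3_sigma f7.
Qed.

Lemma dq_eisR : 2 * dq eisR = eisP * eisR - eisQ ^+ 2.
Proof.
apply: (@fps_int_eq 3) => //.
rewrite eisQE eisRE dqB -[576 * _ * _]mulrA dq_natM dqM dqX.
have alg (K : comNzRingType) (A P Y dA dY : K) :
    6 * dA = A * P - A ^+ 2 + 192 * Y -> 3 * dY = Y * (2 * A + P) ->
    3%:R * (2 * (3%:R * A ^+ 2 * dA - 576 * (dA * Y + A * dY))
       - (P * (A ^+ 3 - 576 * (A * Y)) - (A ^+ 2 + 192 * Y) ^+ 2)) = 0.
  move=> hA hY; transitivity ((3 * A ^+ 2 - 576 * Y) * (6 * dA)
    - 1152 * A * (3 * dY) - 3 * (P * (A ^+ 3 - 576 * A * Y) - (A ^+ 2 + 192 * Y) ^+ 2)).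
    by ring.
  by rewrite hA hY; ring.
exact: alg dq_eisA dq_eisY.
Qed.

Lemma dq_eisX : 3 * dq eisX = eisX * (eisP - eisA).
Proof.
rewrite /eisX dqB dq_natM dqX expr1.
have alg (K : comNzRingType) (A P Y dA dY : K) :
    6 * dA = A * P - A ^+ 2 + 192 * Y -> 3 * dY = Y * (2 * A + P) ->
    3 * (2%:R * A * dA - 64 * dY) = (A ^+ 2 - 64 * Y) * (P - A).
  move=> hA hY; transitivity (A * (6 * dA) - 64 * (3 * dY)); first by ring.
  by rewrite hA hY; ring.
exact: alg dq_eisA dq_eisY.
Qed.

(** * Euler products *)

Arguments coef_fps : simpl never.

Definition fps_of_poly (R : comNzRingType) (p : {poly R}) : fps R := Fps (fun n => p`_n).

Lemma fps_of_polyE (R : comNzRingType) (p : {poly R}) n : fps_of_poly p n = p`_n.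
Proof. by []. Qed.

Lemma fps_of_polyM (R : comNzRingType) (p r : {poly R}) :
  fps_of_poly (p * r) = fps_of_poly p * fps_of_poly r.
Proof. by apply: fpsP => n; rewrite fps_of_polyE coefM fpsM. Qed.

Lemma fps_of_poly1 (R : comNzRingType) : fps_of_poly (1 : {poly R}) = 1.
Proof. by apply: fpsP => n; rewrite fps_of_polyE coef1 fps1E. Qed.

Lemma qXnE (R : comNzRingType) k n : (qX R ^+ k) n = (n == k)%:R.
Proof.
rewrite -[_ ^+ k]mulr1 qXnM fps1E; case: ltngtP => [kn|nk|->] /=.
- by rewrite subn_eq0 leqNgt kn.
- by [].
- by rewrite subnn.
Qed.

(** q^k / (1 - q^k). *)
Definition geom (R : comNzRingType) (k : nat) : fps R :=
  Fps (fun n => ((0 < n) && (k %| n))%N%:R).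

Lemma geomE (R : comNzRingType) k n : geom R k n = ((0 < n) && (k %| n))%N%:R.
Proof. by []. Qed.

Lemma mul_geom (R : comNzRingType) k :
  (0 < k)%N -> (1 - qX R ^+ k) * geom R k = qX R ^+ k.
Proof.
move=> k0; apply: fpsP => n; rewrite mulrBl mul1r fpsB qXnM qXnE !geomE.
have [kn|nk|kn] := ltngtP k n; last by rewrite -kn k0 dvdnn subnn subr0.
  by rewrite subn_gt0 kn (ltn_trans k0 kn) (dvdn_subl (ltnW kn)) ?dvdnn // subrr.
rewrite subr0; case n0: (0 < n)%N => //=.
by case dv: (k %| n)%N => //; have := dvdn_leq n0 dv; rewrite leqNgt nk.
Qed.

Lemma sum_divs (R : nmodType) N n (F : nat -> R) : (0 < n)%N -> (n <= N)%N ->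
  \sum_(i < N | (i.+1 %| n)%N) F i.+1 = \sum_(d <- divs n) F d.
Proof.
move=> n0 nN; rewrite -(big_mkord (fun i => i.+1 %| n)%N (fun i => F i.+1)).
rewrite /divs big_filter.
rewrite -(big_add1 _ _ 0%N N.+1 (fun d => d %| n)%N F) big_mkcond.
rewrite [RHS]big_mkcond (big_cat_nat (n := n.+1)) //=.
rewrite [X in _ + X]big_nat_cond [X in _ + X]big1 ?addr0.
  by rewrite /index_iota subn1.
move=> d /andP[/andP[nd _] _]; case: ifP => // dv.
by have := dvdn_leq n0 dv; rewrite leqNgt nd.
Qed.

Definition euler (m : nat) : fps int := Fps (qpoch m m).

Lemma euler_series m : euler m = Fps (qpoch m m). Proof. by []. Qed.
Lemma eulerE m n : euler m n = qpoch m m n. Proof. by []. Qed.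

Lemma fps_of_qpoch_trunc m N : fps_of_poly (qpoch_trunc m m N) =
  \prod_(i < N) (1 - qX int ^+ (m + m * i)%N).
Proof.
rewrite /qpoch_trunc (big_morph _ (@fps_of_polyM int) (fps_of_poly1 int)).
apply: eq_bigr => i _; apply: fpsP => n.
by rewrite fps_of_polyE coefB coef1 coefXn fpsB fps1E qXnE.
Qed.

Definition euler_trunc (N : nat) : fps int := \prod_(i < N) (1 - qX int ^+ i.+1).

Lemma fps_of_qpoch_trunc1 N : fps_of_poly (qpoch_trunc 1 1 N) = euler_trunc N.
Proof.
by rewrite fps_of_qpoch_trunc; apply: eq_bigr => i _; rewrite mul1n add1n.
Qed.

Lemma euler_agree N : agree N (euler 1) (euler_trunc N).
Proof. by move=> n nN; rewrite -fps_of_qpoch_trunc1 fps_of_polyE qpochE. Qed.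

Lemma euler_vq m : euler m.+1 = vq m.+1 (euler 1).
Proof.
apply: fpsP => n; rewrite eulerE /qpoch -fps_of_polyE fps_of_qpoch_trunc.
transitivity (vq m.+1 (euler_trunc n) n).
  rewrite /euler_trunc rmorph_prod; congr (coef_fps _ n); apply: eq_bigr => i _ /=.
  rewrite vqB vq1 vqX -mulnS exprM; congr (1 - _ ^+ _); apply: fpsP => k.
  rewrite qXnE vqE; have [/dvdnP[e ->]|] := boolP (_ %| k)%N.
    rewrite mulnK // -[X in _ == X](mul1n m.+1) eqn_pmul2r //.
  by have [->|//] := eqVneq k m.+1; rewrite dvdnn.
by rewrite !vqE; case: ifP => // _; rewrite (euler_agree (leq_div _ _)).
Qed.

Lemma euler0 m : euler m 0 = 1. Proof. exact: qpoch0. Qed.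

Lemma dq_prod (R : comNzRingType) N (u l : nat -> fps R) :
  (forall i, dq (u i) = u i * l i) ->
  dq (\prod_(i < N) u i) = (\prod_(i < N) u i) * \sum_(i < N) l i.
Proof.
move=> du; elim: N => [|N IHN]; first by rewrite !big_ord0 dq1 mulr0.
by rewrite !big_ord_recr /= dqM IHN du mulrDr; congr (_ + _); rewrite ?mulrA // mulrAC.
Qed.

Lemma lambert0 (R : comNzRingType) (u : nat -> R) : lambert u 0 = 0.
Proof. exact: big_nil. Qed.

Lemma lambert1 (R : comNzRingType) (u : nat -> R) : lambert u 1 = u 1%N.
Proof. exact: big_seq1. Qed.

Lemma lambert_geom (R : comNzRingType) (u : nat -> R) N n : (n <= N)%N ->
  lambert u n = \sum_(i < N) u i.+1 * geom R i.+1 n.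
Proof.
case: n => [|n] nN.
  by rewrite lambert0 big1 // => i _; rewrite geomE mulr0.
transitivity (\sum_(d <- divs n.+1) u d) => //.
rewrite -(sum_divs u (ltn0Sn n) nN) big_mkcond; apply: eq_bigr => i _.
by rewrite geomE; case: ifP; rewrite ?mulr1 ?mulr0.
Qed.

(** The logarithmic derivative of 1 - q^k is - k q^k / (1 - q^k), and these add up to
    the Lambert series of the identity. *)
Lemma dq_euler : dq (euler 1) = - sigma 1 * euler 1.
Proof.
have du i : dq (1 - qX int ^+ i.+1) =
    (1 - qX int ^+ i.+1) * (- (i.+1%:R * geom int i.+1)).
  rewrite dqB dq1 sub0r mulrN mulrCA mul_geom //; congr (- _); apply: fpsP => n.
  rewrite dqE fps_natM qXnE; case: eqP => [->|_]; first by rewrite mulr1.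
  by rewrite mul0rn mulr0.
apply: fpsP => n; rewrite dqE (euler_agree (leqnn n)) -dqE (dq_prod _ du) mulrC.
symmetry; apply: (agreeM (N := n)) (leqnn n) => [i le_in|]; last exact: euler_agree.
rewrite fpsN (lambert_geom _ le_in) fps_sum -sumrN; apply: eq_bigr => j _.
by rewrite fpsN fps_natM expr1.
Qed.

Lemma dq_euler2 : dq (euler 2) = - (2 * vq 2 (sigma 1)) * euler 2.
Proof. by rewrite euler_vq dq_vq dq_euler vqM raddfN; ring. Qed.

Lemma dqX_log (R : comNzRingType) (f l : fps R) m :
  dq f = l * f -> dq (f ^+ m) = m%:R * l * f ^+ m.
Proof.
case: m => [|m] df; first by rewrite dq1 !mul0r.
by rewrite dqX df exprS; ring.
Qed.

(** Comparing coefficients of q^n in D f = c f gives (n - c(0)) f(n) in terms of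
    the earlier coefficients, so f is determined by those of index at most c(0). *)
Lemma first_order_ode (c f g : fps int) (m : nat) :
  c 0%N = m%:R -> dq f = c * f -> dq g = c * g ->
  (forall n, (n <= m)%N -> f n = g n) -> f = g.
Proof.
move=> c0 df dg fg; apply/eqP; rewrite -subr_eq0; apply/eqP.
have: dq (f - g) = c * (f - g) by rewrite dqB df dg mulrBr.
have: forall n, (n <= m)%N -> (f - g) n = 0.
  by move=> n nm; rewrite fpsB fg // subrr.
move: (f - g) => h h0 dh; apply: fpsP => n; rewrite fps0E.
elim/ltn_ind: n => n IHn; have [/h0 //|mn] := leqP n m.
have := congr1 (fun k : fps int => coef_fps k n) dh; rewrite dqE fpsM big_ord_recl.
rewrite [X in _ + X]big1 ?addr0 /=; last first.
  by move=> i _; rewrite IHn ?mulr0 // /bump; lia.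
rewrite subn0 c0 -[h n *+ n]mulr_natl => /eqP; rewrite -subr_eq0 -mulrBl mulf_eq0.
by case/orP => /eqP //; lia.
Qed.

Lemma fpsX0 (R : comNzRingType) (f : fps R) m : (f ^+ m) 0 = f 0 ^+ m.
Proof.
by elim: m => [|m IHm]; rewrite ?fps1E // !exprS fps_mul_const0 IHm.
Qed.

Lemma eisY0 : eisY 0 = 0.
Proof. by rewrite fpsB vqE /= !lambert0 subrr. Qed.

Lemma eisA0 : eisA 0 = 1.
Proof.
by rewrite eisAE fpsD fpsB !fps_natM fps1E vqE /= lambert0 !mulr0 subr0 addr0.
Qed.

Opaque euler lambert sigma eisY eisA.

(** Both sides have logarithmic derivative (4 P(q^2) - 1) / 3, and start with q. *)
Lemma eisY_euler : eisY * euler 1 ^+ 8 = qX int * euler 2 ^+ 16.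
Proof.
apply: (@first_order_ode (1 - 32 * vq 2 (sigma 1)) _ _ 1).
- by rewrite fpsB fps_natM vqE lambert0 fps1E.
- have := dq_eisY; rewrite dqM (dqX_log _ dq_euler) eisAE /eisP.
  have alg (K : comNzRingType) (Y E S V dY : K) :
     3 * dY = Y * (2 * (1 - 48 * V + 24 * S) + (1 - 24 * S)) ->
     3 * (dY * E + Y * (8%:R * - S * E) - (1 - 32 * V) * (Y * E)) = 0.
    move=> h; transitivity (3 * dY * E - 3 * Y * E * (8 * S + (1 - 32 * V))); first ring.
    by rewrite h; ring.
  by move=> h; apply: (@fps_int_eq 3) => //; apply: alg h.
- rewrite dqM (dqX_log _ dq_euler2).
  have -> : dq (qX int) = qX int.
    apply: fpsP => n; rewrite dqE -[qX int]expr1 qXnE.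
    by case: eqP => [->|_]; rewrite ?mul0rn.
  by ring.
have := fpsX0 (euler 2) 16; have := fpsX0 (euler 1) 8; rewrite !euler0 !expr1n.
move: (euler 1 ^+ 8) (euler 2 ^+ 16) => f g f0 g0 n.
rewrite leq_eqVlt ltnS leqn0 => /orP[] /eqP ->; last first.
  by rewrite !fps_mul_const0 eisY0 [qX int 0]/(0 : int) !mul0r.
rewrite qXM g0 fpsM big_ord_recl big_ord1 eisY0 mul0r add0r.
by rewrite subnn f0 mulr1 fpsB vqE lambert1 expr1n subr0.
Qed.

(** Both sides have logarithmic derivative 2 (P - 1) / 3, and start with 1. *)
Lemma eisX_euler : eisX * euler 2 ^+ 8 = euler 1 ^+ 16.
Proof.
apply: (@first_order_ode (- (16 * sigma 1)) _ _ 0).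
- by rewrite fpsN fps_natM lambert0 mulr0 oppr0.
- have := dq_eisX; rewrite dqM (dqX_log _ dq_euler2) eisAE /eisP.
  have alg (K : comNzRingType) (X E S V dX : K) :
     3 * dX = X * (1 - 24 * S - (1 - 48 * V + 24 * S)) ->
     3 * (dX * E + X * (8%:R * - (2 * V) * E) - (- (16 * S)) * (X * E)) = 0.
    move=> h; transitivity (3 * dX * E + 3 * X * E * (16 * S - 16 * V)); first ring.
    by rewrite h; ring.
  by move=> h; apply: (@fps_int_eq 3) => //; apply: alg h.
- by rewrite (dqX_log _ dq_euler); ring.
have := fpsX0 (euler 2) 8; have := fpsX0 (euler 1) 16; rewrite !euler0 !expr1n.
move: (euler 1 ^+ 16) (euler 2 ^+ 8) => f g f0 g0 n; rewrite leqn0 => /eqP ->.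
rewrite fps_mul_const0 f0 g0 mulr1 fpsB fps_natM (fpsX0 eisA) eisY0 eisA0 expr1n.
by rewrite mulr0 subr0.
Qed.

(** * Reduction modulo 49 *)

Lemma Z49_49 : (49%:R : 'Z_49) = 0. Proof. by apply: val_inj. Qed.

Lemma fps49_49 : (49%:R : fps 'Z_49) = 0.
Proof.
by apply: fpsP => n; rewrite -[49%:R]mulr1 fps_natM Z49_49 mul0r fps0E.
Qed.

Section Characteristic49.
Context (K : comNzRingType) (c49 : 49%:R = 0 :> K).

Lemma frob7D (x y : K) : 7 * (x + y) ^+ 7 = 7 * x ^+ 7 + 7 * y ^+ 7.
Proof.
transitivity (7 * x ^+ 7 + 7 * y ^+ 7 + 49%:R * (x ^+ 6 * y + 3 * x ^+ 5 * y ^+ 2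
  + 5 * x ^+ 4 * y ^+ 3 + 5 * x ^+ 3 * y ^+ 4 + 3 * x ^+ 2 * y ^+ 5 + x * y ^+ 6)).
  by ring.
by rewrite c49 mul0r addr0.
Qed.

Lemma frob7_nat m : 7 * (m%:R ^+ 7) = 7 * m%:R :> K.
Proof.
elim: m => [|m IHm]; first by rewrite expr0n.
by rewrite -[m.+1%:R]natr1 frob7D IHm expr1n mulrDr.
Qed.

Lemma prod_1sub7 N (t : nat -> K) :
  \prod_(i < N) (1 - 7 * t i) = 1 - 7 * \sum_(i < N) t i.
Proof.
elim: N => [|N IHN]; first by rewrite !big_ord0 mulr0 subr0.
rewrite !big_ord_recr /= IHN; move: (\sum_(i < N) _) (t N) => x y.
transitivity (1 - 7 * (x + y) + 49%:R * (x * y)); first by ring.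
by rewrite c49 mul0r addr0.
Qed.

End Characteristic49.

Lemma poly_frob7 (p : {poly 'Z_49}) : 7 * p ^+ 7 = 7 * (p \Po 'X^7).
Proof.
have c49 : 49%:R = 0 :> {poly 'Z_49} by rewrite -polyC1 -polyCMn Z49_49.
elim/poly_ind: p => [|p c IHp].
  by rewrite comp_poly0 expr0n.
rewrite frob7D // comp_polyD comp_polyM comp_polyX comp_polyC mulrDr; congr (_ + _).
  by rewrite exprMn mulrA IHp -mulrA.
by rewrite -[c]natr_Zp polyCMn polyC1 frob7_nat.
Qed.

(** The Frobenius congruence modulo 7, multiplied by 7. *)
Lemma fps_frob7 (f : fps 'Z_49) : 7 * f ^+ 7 = 7 * vq 7 f.
Proof.
have tr N : agree N f (fps_of_poly (fps_trunc f N.+1)).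
  by move=> n nN; rewrite fps_of_polyE coef_poly ltnS nN.
have powE (p : {poly 'Z_49}) m : fps_of_poly p ^+ m = fps_of_poly (p ^+ m).
  by elim: m => [|m IHm]; rewrite ?fps_of_poly1 // !exprS IHm fps_of_polyM.
apply: fpsP => n; rewrite !fps_natM (agreeX 7 (tr n) (leqnn n)) powE fps_of_polyE.
have := congr1 (fun p : {poly 'Z_49} => p`_n) (poly_frob7 (fps_trunc f n.+1)).
rewrite !mulr_natl !coefMn coef_comp_poly_Xn // vqE => ->; congr (_ *+ _).
by case: ifP => // _; rewrite coef_poly ltnS leq_div.
Qed.

Definition red (f : fps int) : fps 'Z_49 := Fps (fun n => (f n)%:~R).

Lemma redE f n : red f n = (f n)%:~R. Proof. by []. Qed.
Lemma redD f g : red (f + g) = red f + red g.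
Proof. by apply: fpsP => n; rewrite redE !fpsD rmorphD. Qed.
Lemma redB f g : red (f - g) = red f - red g.
Proof. by apply: fpsP => n; rewrite redE !fpsB rmorphB. Qed.
Lemma redM f g : red (f * g) = red f * red g.
Proof.
apply: fpsP => n; rewrite redE !fpsM rmorph_sum; apply: eq_bigr => i _.
by rewrite rmorphM.
Qed.
Lemma red1 : red 1 = 1.
Proof. by apply: fpsP => n; rewrite redE !fps1E rmorph_nat. Qed.
Lemma redX f m : red (f ^+ m) = red f ^+ m.
Proof. by elim: m => [|m IHm]; rewrite ?red1 // !exprS redM IHm. Qed.
Lemma red_natM c f : red (c%:R * f) = c%:R * red f.
Proof. by apply: fpsP => n; rewrite redE !fps_natM rmorphM rmorph_nat. Qed.
Lemma redN f : red (- f) = - red f.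
Proof. by apply: fpsP => n; rewrite redE !fpsN rmorphN. Qed.
Lemma red_vq m f : red (vq m f) = vq m (red f).
Proof. by apply: fpsP => n; rewrite redE !vqE; case: ifP. Qed.
Lemma red_dq f : red (dq f) = dq (red f).
Proof. by apply: fpsP => n; rewrite redE !dqE rmorphMn. Qed.
Lemma red_qX : red (qX int) = qX 'Z_49.
Proof. by apply: fpsP => n; rewrite redE -[qX int]expr1 -[qX _]expr1 !qXnE rmorph_nat. Qed.
Lemma red_prod N (u : nat -> fps int) : red (\prod_(i < N) u i) = \prod_(i < N) red (u i).
Proof. exact: (big_morph red redM red1). Qed.

(** (1 - x)^7 = (1 - x^7) (1 - 7 sum_n n^5 x^n) modulo 49: up to a factor -7 the
    logarithm of the quotient is sum x^n / n over n prime to 7, and 1/n = n^5. *)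
Lemma one_sub_pow7 (t := Fps (fun n => n%:R ^+ 5) : fps 'Z_49) :
  (1 - qX _) ^+ 7 = (1 - qX _ ^+ 7) * (1 - 7 * t).
Proof.
have [r rE] : exists r : fps 'Z_49, r = qX _ ^+ 1 - 3 * qX _ ^+ 2 + 5 * qX _ ^+ 3
  - 5 * qX _ ^+ 4 + 3 * qX _ ^+ 5 - qX _ ^+ 6 by eexists.
have ->: (1 - qX _) ^+ 7 = 1 - qX _ ^+ 7 - 7 * r by rewrite rE; ring.
have tE n : t n = n%:R ^+ 5 by [].
clearbody t; rewrite mulrBr mulr1 mulrCA; congr (_ - _); rewrite mulrBl mul1r.
apply: fpsP => n; rewrite !fps_natM fpsB qXnM !tE.
have [n7|n7] := leqP 7 n.
  have -> : r n = 0.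
    rewrite rE !(fpsD, fpsN, fps_natM, qXnE).
    by rewrite !(gtn_eqF (leq_trans _ n7)) // !mulr0 !(oppr0, addr0).
  rewrite mulr0 -[in X in _ = _ * (X - _)](subnK n7) natrD.
  have alg (K : comNzRingType) (c49 : 49%:R = 0 :> K) (x : K) :
      7%:R * ((x + 7%:R) ^+ 5 - x ^+ 5) = 0.
    transitivity (49%:R * (5 * x ^+ 4 + 70 * x ^+ 3 + 490 * x ^+ 2 + 1715 * x + 2401)).
      by ring.
    by rewrite c49 mul0r.
  by rewrite alg // Z49_49.
rewrite subr0 rE !(fpsD, fpsN, fps_natM, qXnE).
by move: n n7; do 7![case=> [|]; first by move=> _; apply: val_inj].
Qed.

(** The prefix m marks reduction modulo 49. *)
Definition mE1 := red (euler 1).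
Definition mE2 := red (euler 2).
Definition mA := red eisA.
Definition mY := red eisY.
Definition mX := red eisX.
Definition mP := red eisP.
Definition mS := red (sigma 5).

(** Taking the product of [one_sub_pow7] over x = q^m: modulo 49 the factors
    1 - 7 sum n^5 q^(m n) multiply by adding their second terms, which gives sigma_5. *)
Lemma mE1_pow7 : mE1 ^+ 7 = vq 7 mE1 * (1 - 7 * mS).
Proof.
have c49 := fps49_49.
pose t := Fps (fun n => n%:R ^+ 5) : fps 'Z_49.
have tE n : t n = n%:R ^+ 5 by [].
pose u i := 1 - qX 'Z_49 ^+ i.+1.
have vq_qX m k : vq m.+1 (qX 'Z_49 ^+ k) = qX _ ^+ (m.+1 * k).
  apply: fpsP => n; rewrite vqE !qXnE; have [/dvdnP[e ->]|] := boolP (_ %| n)%N.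
    by rewrite mulnK // mulnC eqn_pmul2l.
  by have [->|//] := eqVneq n (m.+1 * k)%N; rewrite dvdn_mulr.
have vq_u i : vq i.+1 (1 - qX _) = u i.
  by rewrite vqB vq1 -[X in vq _ X]expr1 vq_qX muln1.
have u7 i : u i ^+ 7 = vq 7 (u i) * (1 - 7 * vq i.+1 t).
  rewrite -vq_u -vqX one_sub_pow7 vqM !vqB !vq1 vq_natM vq_qX; congr ((1 - _) * _).
  by rewrite -[X in vq i.+1 X]expr1 !vq_qX muln1 mulnC.
have tr N : agree N mE1 (\prod_(i < N) u i).
  move=> n nN; transitivity (red (euler_trunc N) n).
    by rewrite /mE1 !redE (euler_agree nN).
  rewrite /euler_trunc (red_prod N (fun i => 1 - qX int ^+ i.+1)).
  by congr (coef_fps _ n); apply: eq_bigr => i _; rewrite redB red1 redX red_qX.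
apply: fpsP => n; rewrite (agreeX 7 (tr n) (leqnn n)) -prodrXl.
transitivity ((vq 7 (\prod_(i < n) u i) * (1 - 7 * \sum_(i < n) vq i.+1 t)) n).
  congr (coef_fps _ n); rewrite rmorph_prod -(prod_1sub7 c49 n (fun i => vq i.+1 t)).
  by rewrite -big_split; apply: eq_bigr => i _; rewrite u7.
apply: (@agreeM _ n) => // m mn.
  by rewrite !vqE; case: ifP => // _; rewrite (tr n) // (leq_trans _ mn) ?leq_div.
rewrite !fpsB !fps_natM fps_sum redE; congr (_ - _ * _).
case: m mn => [|m] mn.
  by rewrite lambert0 big1 // => i _; rewrite vqE dvdn0 div0n tE expr0n.
transitivity (\sum_(d <- divs m.+1) ((m.+1 %/ d)%:R : 'Z_49) ^+ 5).
  rewrite -(sum_divs _ (ltn0Sn m) mn) [RHS]big_mkcond.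
  by apply: eq_bigr => i _; rewrite vqE tE.
rewrite (divs_codiv m.+1 (fun d => d%:R ^+ 5)) -[RHS]/(intmul 1 (\sum_(d <- divs m.+1) _)).
by rewrite rmorph_sum; apply: eq_bigr => d _; rewrite rmorphXn /= rmorph_nat.
Qed.

Definition fps_inv (f : fps int) : fps int := Fps (ser_inv f).

Lemma fps_mulV (f : fps int) : f 0 = 1 -> f * fps_inv f = 1.
Proof. by move=> f0; apply: fpsP => n; rewrite fps1E; apply: (ser_mulV n f0). Qed.

Lemma red_unit (f : fps int) : f 0 = 1 -> red f * red (fps_inv f) = 1.
Proof. by move=> f0; rewrite -redM fps_mulV // red1. Qed.

Definition mAi := red (fps_inv eisA).

Lemma mA_inv : mA * mAi = 1. Proof. exact/red_unit/eisA0. Qed.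

Lemma red_congr (f g : fps int) : f = g -> red f = red g. Proof. by move->. Qed.

Lemma unit_mulI (K : comNzRingType) (u v x y : K) : u * v = 1 -> u * x = u * y -> x = y.
Proof. by move=> uv e; rewrite -[x]mul1r -[y]mul1r -uv -!mulrA [v * x]mulrC [v * y]mulrC !mulrA e. Qed.

(** Modulo 49 this reads R = 1 - 14 S. *)
Lemma mR_eq : 1 - 504 * mS = mA ^+ 3 - 576 * mA * mY.
Proof.
transitivity (red eisR); first by rewrite /eisR redB red1 red_natM.
by rewrite (red_congr eisRE) redB redX redM red_natM.
Qed.

Lemma mX_eq : mX = mA ^+ 2 - 64 * mY.
Proof. by rewrite /mX redB redX red_natM. Qed.

Lemma mY_euler : mY * mE1 ^+ 8 = qX _ * mE2 ^+ 16.
Proof. by rewrite -redX -redM eisY_euler redM redX red_qX. Qed.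

Lemma mX_euler : mX * mE2 ^+ 8 = mE1 ^+ 16.
Proof. by rewrite -redX -redM eisX_euler redX. Qed.

Lemma mE2_vq : mE2 = vq 2 mE1.
Proof. by rewrite /mE2 euler_vq red_vq. Qed.

Lemma mS_vq2 : vq 2 mS = mS - mA * mY.
Proof. by rewrite -red_vq vq2_sigma5 redB redM. Qed.

Lemma mE2_pow7 : mE2 ^+ 7 = vq 7 mE2 * (1 - 7 * (mS - mA * mY)).
Proof.
rewrite mE2_vq -vqX mE1_pow7 vqM vqB vq1 vq_natM mS_vq2; congr (_ * _).
by rewrite !vq_vq.
Qed.

Lemma mPE : mP = 1 - 24 * red (sigma 1).
Proof. by rewrite /mP redB red1 red_natM. Qed.

Lemma mAE : mA = 1 - 48 * red (vq 2 (sigma 1)) + 24 * red (sigma 1).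
Proof. by rewrite /mA eisAE redD redB red1 !red_natM. Qed.

Lemma dq_mE1 : dq mE1 = - 2 * (mP - 1) * mE1.
Proof.
rewrite -red_dq dq_euler redM redN mPE -/mE1.
have alg (K : comNzRingType) (c49 : 49%:R = 0 :> K) (s e : K) :
    - s * e = - 2 * (1 - 24 * s - 1) * e.
  transitivity (- s * e + 49%:R * s * e); last by ring.
  by rewrite c49 !mul0r addr0.
exact: alg fps49_49 _ _.
Qed.

Lemma dq_mE2 : dq mE2 = - 2 * (mA + mP - 2) * mE2.
Proof.
rewrite -red_dq dq_euler2 redM redN red_natM mPE mAE -/mE2.
have alg (K : comNzRingType) (c49 : 49%:R = 0 :> K) (v s e : K) :
    - (2%:R * v) * e = - 2 * (1 - 48 * v + 24 * s + (1 - 24 * s) - 2) * e.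
  transitivity (- (2%:R * v) * e + 49%:R * (2 * v) * e); last by ring.
  by rewrite c49 !mul0r addr0.
exact: alg fps49_49 _ _ _.
Qed.

Lemma dq_mA : dq mA = - 8 * (mA * mP - mA ^+ 2 + 192 * mY).
Proof.
have := red_congr dq_eisA; rewrite red_natM red_dq.
have -> : red (eisA * eisP - eisA ^+ 2 + 192 * eisY) = mA * mP - mA ^+ 2 + 192 * mY.
  by rewrite redD redB redM redX red_natM.
have alg (K : comNzRingType) (c49 : 49%:R = 0 :> K) (d z : K) :
    6%:R * d = z -> d = - 8 * z.
  move=> <-; transitivity (d - 49%:R * d); last by ring.
  by rewrite c49 mul0r subr0.
exact: alg fps49_49 _ _.
Qed.

Definition mQ := mA ^+ 2 + 192 * mY.

Lemma dq_mR : - (1008 * dq mS) = mP * (1 - 504 * mS) - mQ ^+ 2.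
Proof.
have mR : red eisR = 1 - 504 * mS by rewrite redB red1 red_natM.
have := red_congr dq_eisR; rewrite eisQE red_natM red_dq mR.
have -> : red (eisP * eisR - (eisA ^+ 2 + 192 * eisY) ^+ 2) =
    mP * (1 - 504 * mS) - mQ ^+ 2.
  have mQ : red (eisA ^+ 2 + 192 * eisY) = mQ.
    by rewrite redD redX red_natM.
  by rewrite redB redX mQ redM mR.
rewrite dqB dq1 dq_natM => <-.
have alg (K : comNzRingType) (d : K) : - (1008 * d) = 2%:R * (0 - 504%:R * d) by ring.
exact: alg.
Qed.

(** The logarithmic derivative of E(q)^7 = E(q^7) (1 - 7 S). On the right it involves
    7 P(q^7), which is 7 P^7. *)
Lemma dq_mS_vq : 7 * dq mS = 14 * (mP - mP ^+ 7).
Proof.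
have := congr1 (@dq _) mE1_pow7.
rewrite dqX dqM dq_vq dqB dq1 dq_natM dq_mE1 vqM.
have -> : vq 7 (- 2 * (mP - 1)) = - 2 * (vq 7 mP - 1).
  by rewrite mulNr raddfN /= vq_natM vqB vq1 mulNr.
have vE : vq 7 mE1 * vq 7 (red (fps_inv (euler 1))) = 1.
  by rewrite -vqM red_unit ?vq1 // euler0.
have alg (K : comNzRingType) (c49 : 49%:R = 0 :> K) (E P p S v vi d : K) :
    E ^+ 7 = v * (1 - 7 * S) -> v * vi = 1 -> 7 * P ^+ 7 = 7 * p ->
    7%:R * E ^+ 6 * (- 2 * (P - 1) * E) =
      7%:R * (- 2 * (p - 1) * v) * (1 - 7 * S) + v * (0 - 7 * d) ->
    7 * d = 14 * (P - P ^+ 7).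
  move=> hE vvi hp h; apply: (unit_mulI vvi).
  transitivity (7%:R * (- 2 * (p - 1) * v) * (1 - 7 * S)
     - (7%:R * (- 2 * (p - 1) * v) * (1 - 7 * S) + v * (0 - 7 * d))); first ring.
  rewrite -h; transitivity (7%:R * (- 2 * (p - 1) * v) * (1 - 7 * S)
     + 14 * (P - 1) * E ^+ 7); first ring.
  rewrite hE; transitivity (v * (14 * P - 2 * (7 * p)) - 49%:R * (2 * v * S * (P - p))).
    by ring.
  by rewrite c49 -hp; ring.
exact: (alg _ fps49_49 mE1 mP (vq 7 mP) mS _ _ (dq mS) mE1_pow7 vE (fps_frob7 mP)).
Qed.

(** Seven times 2 D R = P R - Q^2, since R = 1 modulo 7. *)
Lemma mP_mod7 : 7 * mP = 7 * mQ ^+ 2.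
Proof.
have alg (K : comNzRingType) (c49 : 49%:R = 0 :> K) (P Q S d : K) :
    - (1008 * d) = P * (1 - 504 * S) - Q ^+ 2 -> 7 * P = 7 * Q ^+ 2.
  move=> h; transitivity (7 * Q ^+ 2 + 7 * (P * (1 - 504 * S) - Q ^+ 2)
    + 49%:R * (72 * P * S)); first ring.
  by rewrite -h; transitivity (7 * Q ^+ 2 + 49%:R * (72 * P * S - 144 * d)); [ring|
    rewrite c49; ring].
exact: (alg _ fps49_49 mP mQ mS (dq mS) dq_mR).
Qed.

Lemma dq_mS : 7 * dq mS = 14 * (mQ ^+ 2 - mQ ^+ 14).
Proof.
have alg (K : comNzRingType) (P Q d : K) : 7 * P = 7 * Q ^+ 2 ->
    7 * d = 14 * (P - P ^+ 7) -> 7 * d = 14 * (Q ^+ 2 - Q ^+ 14).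
  move=> h ->; have pw m : 7 * P ^+ m = 7 * (Q ^+ 2) ^+ m.
    elim: m => // m IHm; rewrite exprS mulrA h -mulrA [_ * P ^+ m]mulrC.
    by rewrite mulrA IHm -mulrA -exprSr.
  transitivity (2 * (7 * P) - 2 * (7 * P ^+ 7)); first ring.
  by rewrite pw h; ring.
exact: (alg _ mP mQ (dq mS) mP_mod7 dq_mS_vq).
Qed.

(** 2 D R = P R - Q^2 solved for P: the left-hand side is - 28 D S, known by
    [dq_mS], and R is inverted by 1 + 14 S. *)
Lemma mP_eq : mP = (1 + 14 * mS) * (7 * mQ ^+ 14 - 6 * mQ ^+ 2).
Proof.
have alg (K : comNzRingType) (c49 : 49%:R = 0 :> K) (P Q S d : K) :
    - (1008 * d) = P * (1 - 504 * S) - Q ^+ 2 ->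
    7 * d = 14 * (Q ^+ 2 - Q ^+ 14) ->
    P = (1 + 14 * S) * (7 * Q ^+ 14 - 6 * Q ^+ 2).
  move=> h hd; have e : P * (1 - 504 * S) = Q ^+ 2 - 2016 * (Q ^+ 2 - Q ^+ 14).
    transitivity (Q ^+ 2 + (P * (1 - 504 * S) - Q ^+ 2)); first ring.
    by rewrite -h; transitivity (Q ^+ 2 - 144 * (7 * d)); [|rewrite hd]; ring.
  transitivity (P * (1 - 504 * S) * (1 + 14 * S) + 49%:R * (P * (10 * S + 144 * S ^+ 2))).
    by ring.
  rewrite e; transitivity ((1 + 14 * S) * (7 * Q ^+ 14 - 6 * Q ^+ 2)
    + 49%:R * ((1 + 14 * S) * (41 * Q ^+ 14 - 41 * Q ^+ 2) + P * (10 * S + 144 * S ^+ 2))).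
    by ring.
  by rewrite c49 mul0r addr0.
exact: (alg _ fps49_49 mP mQ mS (dq mS) dq_mR dq_mS).
Qed.

(** R = A^3 - 576 A Y solved for Y; 4 is the inverse of 576. *)
Lemma mY_eq : mY = 4 * mAi * (mA ^+ 3 - 1 + 14 * mS).
Proof.
have alg (K : comNzRingType) (c49 : 49%:R = 0 :> K) (A B Y S : K) :
    A * B = 1 -> 1 - 504 * S = A ^+ 3 - 576 * A * Y ->
    Y = 4 * B * (A ^+ 3 - 1 + 14 * S).
  move=> AB h; apply: (unit_mulI AB).
  transitivity (4 * (A ^+ 3 - (A ^+ 3 - 576 * A * Y)) - 49%:R * (47 * A * Y)); first ring.
  rewrite -h c49 mul0r subr0; transitivity (A * B * (4 * (A ^+ 3 - 1 + 14 * S))); last ring.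
  by rewrite AB; transitivity (4 * (A ^+ 3 - 1 + 14 * S) + 49%:R * (40 * S)); [ring|
    rewrite c49; ring].
exact: (alg _ fps49_49 mA mAi mY mS mA_inv mR_eq).
Qed.

Lemma Z49_all (P : pred 'Z_49) : all P [seq inZp i | i <- iota 0 49] -> forall x, P x.
Proof.
move=> /allP allP x; rewrite -[x]valZpK; apply/allP/map_f.
by rewrite mem_iota /= ltn_ord.
Qed.

(** Fermat's theorem modulo 7, in the two forms used to separate the classes of
    exponents. *)
Lemma Z49_pow6 (n : nat) (x := n%:R : 'Z_49) :
  if (7 %| n)%N then x ^+ 6 = 0 else 7 * x ^+ 6 = 7 /\ (1 - x ^+ 6) ^+ 2 = 0.
Proof.
have dvE : (7 %| n)%N = (7 %| (x : nat))%N.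
  by rewrite /x val_Zp_nat // /dvdn modn_dvdm.
pose P (y : 'Z_49) := if (7 %| (y : nat))%N then y ^+ 6 == 0
  else (7 * y ^+ 6 == 7) && ((1 - y ^+ 6) ^+ 2 == 0).
have Pall : all P [seq inZp i | i <- iota 0 49] by vm_compute.
have := Z49_all Pall x; rewrite /P -dvE; clearbody x.
case: (7 %| n)%N => [/eqP e|/andP[/eqP e1 /eqP e2]]; first exact: e.
by split; [exact: e1 | exact: e2].
Qed.

(** D^6 keeps, modulo 7, the coefficients of index prime to 7. On the others,
    sigma_5(7 m) = sigma_5(m) modulo 7: the divisors of 7 m that count are those
    prime to 7, and they divide m. *)
Lemma mS_vq7 : 7 * vq 7 mS = 7 * mS - 7 * iter 6 (@dq _) mS.
Proof.
apply: fpsP => n; rewrite fpsB !fps_natM vqE.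
have it m (f : fps 'Z_49) : iter m (@dq _) f n = n%:R ^+ m * f n.
  by elim: m => [|m IHm]; rewrite ?mul1r // iterS dqE IHm exprS -mulrA mulr_natl.
have pow7 : 7%:R ^+ 6 = 0 :> 'Z_49 by apply: val_inj.
have mSE k : mS k = \sum_(d <- divs k) (d%:R : 'Z_49) ^+ 5.
  rewrite -[mS k]/(intmul 1 (\sum_(d <- divs k) _)).
  by rewrite rmorph_sum; apply: eq_bigr => d _; rewrite rmorphXn /= rmorph_nat.
rewrite it; case: ifP => [/dvdnP[m ->]|ndiv].
  rewrite (mulnK m (isT : 0 < 7)%N) (natrM _ m 7) (exprMn _ m%:R) pow7.
  rewrite mulr0 mul0r mulr0 subr0.
  case: m => [|m]; first by rewrite mul0n.
  rewrite !mSE -(sum_divs _ (ltn0Sn m) (leq_pmulr m.+1 (isT : 0 < 7)%N)).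
  rewrite -(sum_divs _ (isT : 0 < m.+1 * 7)%N (leqnn _)) !mulr_sumr.
  rewrite big_mkcond [RHS]big_mkcond.
  apply: eq_bigr => i _; have [/dvdnP[k ->]|co] := boolP (7 %| i.+1)%N.
    have -> : 7 * (k * 7)%:R ^+ 5 = 0 :> 'Z_49.
      by rewrite (natrM _ k 7) exprMn mulrCA -exprS pow7 mulr0.
    by rewrite !if_same.
  have cop : coprime i.+1 7 by rewrite coprime_sym prime_coprime.
  by rewrite (Gauss_dvdl _ cop).
have := Z49_pow6 n; rewrite ndiv => -[u7 _].
by rewrite mulr0 [7 * (_ * mS n)]mulrA u7 subrr.
Qed.

(** * Computing with forms modulo 49 *)

Notation K49 := (fps 'Z_49).

Notation binN := BinNums.N.

Definition n0 : binN := BinNums.N0.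
Definition n1 : binN := Eval compute in BinNat.N.of_nat 1.
Definition n48 : binN := Eval compute in BinNat.N.of_nat 48.
Definition n49 : binN := Eval compute in BinNat.N.of_nat 49.

Definition mod49 (c : binN) : binN := BinNat.N.modulo c n49.
Definition cadd (c d : binN) : binN := mod49 (BinNat.N.add c d).
Definition cmul (c d : binN) : binN := mod49 (BinNat.N.mul c d).
Definition cval (c : binN) : K49 := (BinNat.N.to_nat c)%:R.

Lemma cval_mod49 c : cval (mod49 c) = cval c.
Proof.
rewrite /cval /mod49 [in RHS](BinNat.N.div_mod' c n49) Nnat.N2Nat.inj_add Nnat.N2Nat.inj_mul.
have -> : BinNat.N.to_nat n49 = 49%N by [].
by rewrite plusE multE natrD natrM fps49_49 mul0r add0r.
Qed.

Lemma cval_add c d : cval (cadd c d) = cval c + cval d.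
Proof. by rewrite cval_mod49 /cval Nnat.N2Nat.inj_add plusE natrD. Qed.

Lemma cval_mul c d : cval (cmul c d) = cval c * cval d.
Proof. by rewrite cval_mod49 /cval Nnat.N2Nat.inj_mul multE natrM. Qed.

Lemma cval0 : cval n0 = 0. Proof. by []. Qed.
Lemma cval1 : cval n1 = 1. Proof. by []. Qed.

(** Lists of coefficients stand for polynomials in A, the constant one first. *)
Definition peval (l : seq binN) : K49 := foldr (fun c r => cval c + mA * r) 0 l.

Fixpoint padd (l m : seq binN) : seq binN :=
  match l, m with
  | [::], _ => m
  | _, [::] => l
  | c :: l', d :: m' => cadd c d :: padd l' m'
  end.

Definition pmul (l m : seq binN) : seq binN :=
  foldr (fun c r => padd (map (cmul c) m) (n0 :: r)) [::] l.

Lemma peval_add l m : peval (padd l m) = peval l + peval m.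
Proof.
elim: l m => [|c l IHl] [|d m] /=; rewrite ?add0r ?addr0 //.
by rewrite IHl cval_add; ring.
Qed.

Lemma peval_scale c l : peval (map (cmul c) l) = cval c * peval l.
Proof. by elim: l => [|d l IHl] /=; rewrite ?mulr0 // IHl cval_mul; ring. Qed.

Lemma peval_mul l m : peval (pmul l m) = peval l * peval m.
Proof.
elim: l => [|c l IHl] /=; first by rewrite mul0r.
by rewrite peval_add peval_scale /= IHl cval0; ring.
Qed.

Lemma peval_shift k l : peval (nseq k n0 ++ l) = mA ^+ k * peval l.
Proof.
elim: k => [|k IHk] /=; first by rewrite mul1r.
by rewrite IHk cval0 add0r exprS mulrA.
Qed.

(** The coefficients of A^(1 - c) d(A^c l(A))/dA; a negative c is given modulo 49. *)
Fixpoint pder (c : binN) (l : seq binN) : seq binN :=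
  if l is d :: l' then cmul c d :: pder (cadd c n1) l' else [::].

Lemma peval_der c l :
  mA * dq (peval l) = (peval (pder c l) - cval c * peval l) * dq mA.
Proof.
elim: l c => [|d l IHl] c /=; first by rewrite raddf0 !mulr0 subr0 mul0r.
rewrite dqD dqM dq_nat add0r mulrDr (IHl (cadd c n1)) cval_mul cval_add cval1; ring.
Qed.

(** Laurent polynomials: the pair (k, l) stands for A^-k l(A). *)
Definition laurent := (nat * seq binN)%type.
Definition leval (a : laurent) : K49 := mAi ^+ a.1 * peval a.2.
Definition ladd (a b : laurent) : laurent :=
  (maxn a.1 b.1, padd (nseq (b.1 - a.1) n0 ++ a.2) (nseq (a.1 - b.1) n0 ++ b.2)).
Definition lmul (a b : laurent) : laurent := ((a.1 + b.1)%N, pmul a.2 b.2).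
Definition lder (a : laurent) : laurent :=
  (a.1.+1, pder (cmul n48 (BinNat.N.of_nat a.1)) a.2).

Lemma mAi_shift k j : mAi ^+ (k + j) * mA ^+ j = mAi ^+ k.
Proof. by rewrite exprD -mulrA -exprMn [mAi * _]mulrC mA_inv expr1n mulr1. Qed.

Lemma leval_add a b : leval (ladd a b) = leval a + leval b.
Proof.
case: a b => [k l] [j m]; rewrite /leval /= peval_add !peval_shift mulrDr !mulrA.
congr (_ * _ + _ * _); first by rewrite maxnE mAi_shift.
by rewrite maxnC maxnE mAi_shift.
Qed.

Lemma leval_mul a b : leval (lmul a b) = leval a * leval b.
Proof. by rewrite /leval /= peval_mul exprD; ring. Qed.

Lemma cval48 k : cval (cmul n48 (BinNat.N.of_nat k)) = - k%:R.
Proof.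
rewrite cval_mul /cval Nnat.Nat2N.id; have -> : BinNat.N.to_nat n48 = 48%N by [].
apply/eqP; rewrite -subr_eq0 opprK; apply/eqP.
by transitivity (49%:R * k%:R : K49); [ring | rewrite fps49_49 mul0r].
Qed.

Lemma dq_mAi : dq mAi = - mAi ^+ 2 * dq mA.
Proof.
apply: (unit_mulI mA_inv); have := congr1 (@dq _) mA_inv; rewrite dqM dq1.
move=> /(congr1 (fun x => x - dq mA * mAi)); rewrite [_ + mA * _]addrC addrK sub0r => ->.
by transitivity (- (mA * mAi) * mAi * dq mA); [rewrite mA_inv | ]; ring.
Qed.

Lemma leval_der a : dq (leval a) = leval (lder a) * dq mA.
Proof.
case: a => k l; rewrite /leval /lder /= dqM.
have -> : dq (mAi ^+ k) = - k%:R * mAi ^+ k.+1 * dq mA.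
  case: k => [|k]; first by rewrite dq1 oppr0 !mul0r.
  by rewrite dqX dq_mAi [mAi ^+ k.+2]exprSr [mAi ^+ k.+1]exprSr; ring.
have -> : mAi ^+ k * dq (peval l) = mAi ^+ k.+1 * (mA * dq (peval l)).
  by rewrite exprSr -mulrA [mAi * (mA * _)]mulrA [mAi * mA]mulrC mA_inv mul1r.
by rewrite (peval_der (cmul n48 (BinNat.N.of_nat k))) cval48; ring.
Qed.

(** The pair (g, h) stands for g(A) + 7 S h(A). *)
Definition form := (laurent * laurent)%type.
Definition feval (a : form) : K49 := leval a.1 + 7 * mS * leval a.2.
Definition l0 : laurent := (0%N, [::]).
Definition fnat (n : nat) : form := ((0%N, [:: mod49 (BinNat.N.of_nat n)]), l0).
Definition fadd (a b : form) : form := (ladd a.1 b.1, ladd a.2 b.2).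
Definition fmul (a b : form) : form :=
  (lmul a.1 b.1, ladd (lmul a.1 b.2) (lmul a.2 b.1)).
Definition fopp (a : form) : form := fmul (fnat 48) a.
Definition fexp (a : form) (n : nat) : form := iter n (fmul a) (fnat 1).

Definition represents (x : K49) (a : form) : Prop := x = feval a.

Lemma leval0 : leval l0 = 0.
Proof. by rewrite /leval /= mulr0. Qed.

Lemma represents_nat n : represents n%:R (fnat n).
Proof.
rewrite /represents /feval leval0 /leval /= cval_mod49 /cval Nnat.Nat2N.id.
by rewrite !mulr0 !addr0 mul1r.
Qed.

Lemma represents_add x y a b :
  represents x a -> represents y b -> represents (x + y) (fadd a b).
Proof. by move=> -> ->; rewrite /represents /feval /= !leval_add; ring. Qed.

Lemma represents_mul x y a b :
  represents x a -> represents y b -> represents (x * y) (fmul a b).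
Proof.
move=> -> ->; rewrite /represents /feval /= leval_add !leval_mul.
have alg (K : comNzRingType) (c49 : 49%:R = 0 :> K) (s g h g' h' : K) :
    (g + 7 * s * h) * (g' + 7 * s * h') = g * g' + 7 * s * (g * h' + h * g').
  transitivity (g * g' + 7 * s * (g * h' + h * g') + 49%:R * (s ^+ 2 * h * h')).
    by ring.
  by rewrite c49 mul0r addr0.
exact: alg fps49_49 _ _ _ _ _.
Qed.

Lemma represents_opp x a : represents x a -> represents (- x) (fopp a).
Proof.
move=> xa; rewrite /fopp; have -> : - x = 48%:R * x.
  apply/eqP; rewrite -subr_eq0 -opprD oppr_eq0; apply/eqP.
  by transitivity (49%:R * x : K49); [ring | rewrite fps49_49 mul0r].
by apply: represents_mul xa; apply: represents_nat.
Qed.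

Lemma represents_exp x a n : represents x a -> represents (x ^+ n) (fexp a n).
Proof.
move=> xa; elim: n => [|n IHn]; first exact: (represents_nat 1).
by rewrite exprS; apply: represents_mul.
Qed.

Definition fA : form := ((0%N, [:: n0; n1]), l0).
Definition fAi : form := ((1%N, [:: n1]), l0).
Definition f7S : form := (l0, (0%N, [:: n1])).

Lemma represents_A : represents mA fA.
Proof. by rewrite /represents /feval leval0 /leval /= cval0 cval1; ring. Qed.
Lemma represents_Ai : represents mAi fAi.
Proof. by rewrite /represents /feval leval0 /leval /= cval1; ring. Qed.
Lemma represents_7S : represents (7 * mS) f7S.
Proof. by rewrite /represents /feval leval0 /leval /= cval1; ring. Qed.

Definition f14S : form := fmul (fnat 2) f7S.
Definition fY : form := Eval vm_compute in
  fmul (fmul (fnat 4) fAi) (fadd (fadd (fexp fA 3) (fopp (fnat 1))) f14S).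
Definition fQ : form := Eval vm_compute in fadd (fexp fA 2) (fmul (fnat 192) fY).
Definition fP : form := Eval vm_compute in
  fmul (fadd (fnat 1) f14S)
    (fadd (fmul (fnat 7) (fexp fQ 14)) (fopp (fmul (fnat 6) (fexp fQ 2)))).
Definition fDA : form := Eval vm_compute in
  fmul (fopp (fnat 8))
    (fadd (fadd (fmul fA fP) (fopp (fexp fA 2))) (fmul (fnat 192) fY)).
Definition f7DS : form := Eval vm_compute in
  fmul (fnat 14) (fadd (fexp fQ 2) (fopp (fexp fQ 14))).

Lemma represents_14S : represents (14 * mS) f14S.
Proof.
have -> : 14 * mS = 2%:R * (7 * mS) by ring.
by apply: represents_mul represents_7S; apply: represents_nat.
Qed.

Lemma represents_Y : represents mY fY.
Proof.
have -> : fY = fmul (fmul (fnat 4) fAi) (fadd (fadd (fexp fA 3) (fopp (fnat 1))) f14S).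
  by vm_compute.
rewrite mY_eq; apply: represents_mul.
  exact: represents_mul (represents_nat 4) represents_Ai.
apply: represents_add represents_14S; apply: represents_add.
  exact: represents_exp 3 represents_A.
exact: represents_opp (represents_nat 1).
Qed.

Lemma represents_Q : represents mQ fQ.
Proof.
have rY := represents_Y.
have -> : fQ = fadd (fexp fA 2) (fmul (fnat 192) fY) by vm_compute.
apply: represents_add; first exact: represents_exp 2 represents_A.
exact: represents_mul (represents_nat 192) rY.
Qed.

Lemma represents_P : represents mP fP.
Proof.
have rQ := represents_Q.
have -> : fP = fmul (fadd (fnat 1) f14S)
    (fadd (fmul (fnat 7) (fexp fQ 14)) (fopp (fmul (fnat 6) (fexp fQ 2)))).
  by vm_compute.
rewrite mP_eq; apply: represents_mul.
  exact: represents_add (represents_nat 1) represents_14S.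
apply: represents_add; first exact: represents_mul (represents_nat 7) (represents_exp 14 rQ).
apply: represents_opp; exact: represents_mul (represents_nat 6) (represents_exp 2 rQ).
Qed.

Lemma represents_DA : represents (dq mA) fDA.
Proof.
have rY := represents_Y; have rP := represents_P.
have -> : fDA = fmul (fopp (fnat 8))
    (fadd (fadd (fmul fA fP) (fopp (fexp fA 2))) (fmul (fnat 192) fY)).
  by vm_compute.
rewrite dq_mA; apply: represents_mul; first exact: represents_opp (represents_nat 8).
apply: represents_add; last exact: represents_mul (represents_nat 192) rY.
apply: represents_add; first exact: represents_mul represents_A rP.
exact: represents_opp (represents_exp 2 represents_A).
Qed.

Lemma represents_7DS : represents (7 * dq mS) f7DS.
Proof.
have rQ := represents_Q.
have -> : f7DS = fmul (fnat 14) (fadd (fexp fQ 2) (fopp (fexp fQ 14))).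
  by vm_compute.
rewrite dq_mS; apply: represents_mul; first exact: (represents_nat 14).
apply: represents_add; first exact: represents_exp 2 rQ.
exact: represents_opp (represents_exp 14 rQ).
Qed.

(** The derivative of g(A) + 7 S h(A); 7 D S is itself a form. *)
Definition fder (a : form) : form :=
  fadd (fmul (lder a.1, lder a.2) fDA) (fmul f7DS (a.2, l0)).

Lemma represents_der x a : represents x a -> represents (dq x) (fder a).
Proof.
move=> ->.
have -> : dq (feval a) = feval (lder a.1, lder a.2) * dq mA + 7 * dq mS * leval a.2.
  rewrite /feval dqD -mulrA dq_natM dqM !leval_der /=; ring.
have ra (b : laurent) : represents (leval b) (b, l0).
  by rewrite /represents /feval leval0 /= mulr0 addr0.
apply: represents_add; apply: represents_mul => //; first exact: represents_DA.
exact: represents_7DS.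
Qed.

(** The part h enters with the factor 7, so it matters only modulo 7. *)
Definition fzero (a : form) : bool :=
  all (BinNat.N.eqb n0) a.1.2 && all (fun c => BinNat.N.eqb n0 (cmul (BinNat.N.of_nat 7) c)) a.2.2.

Lemma eqb0 c : BinNat.N.eqb n0 c -> c = n0.
Proof. by move=> h; have [-> //] := BinNat.N.eqb_eq n0 c. Qed.

Lemma fzeroP a : fzero a -> feval a = 0.
Proof.
case: a => [[k l] [j m]] /andP[/= zl zm]; rewrite /feval /leval /=.
have -> : peval l = 0.
  elim: l zl => //= c l IHl /andP[/eqb0 -> /IHl ->].
  by rewrite cval0 mulr0 addr0.
have e : 7%:R * peval m = 0.
  elim: m zm => [|c m IHm] /=; first by rewrite mulr0.
  case/andP => /eqb0 c0 /IHm e.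
  have {c0} c0 : 7%:R * cval c = 0.
    by transitivity (cval (cmul (BinNat.N.of_nat 7) c)); [rewrite cval_mul | rewrite c0].
  by rewrite mulrDr c0 add0r mulrCA e mulr0.
rewrite mulr0 add0r; transitivity (mS * mAi ^+ j * (7%:R * peval m)); first ring.
by rewrite e mulr0.
Qed.

Lemma represents_eq x y a b :
  represents x a -> represents y b -> fzero (fadd a (fopp b)) -> x = y.
Proof.
move=> xa yb z; apply/eqP; rewrite -subr_eq0; apply/eqP; rewrite -(fzeroP z).
by apply: represents_add => //; apply: represents_opp.
Qed.

(** If D u + c u = w u, then D + c acts on the product u g as D + w acts on g. *)
Definition twist (w x : K49) : K49 := dq x + w * x.
Definition ftwist (w a : form) : form := fadd (fder a) (fmul w a).
Definition twist_project (w x : K49) : K49 := x - iter 6 (twist w) x.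
Definition ftwist_project (w a : form) : form := fadd a (fopp (iter 6 (ftwist w) a)).

Lemma represents_twist w x fw a :
  represents w fw -> represents x a -> represents (twist w x) (ftwist fw a).
Proof.
move=> ww xa; apply: represents_add; first exact: represents_der.
exact: represents_mul.
Qed.

Lemma represents_iter_twist w x fw a n : represents w fw -> represents x a ->
  represents (iter n (twist w) x) (iter n (ftwist fw) a).
Proof. by move=> ww xa; elim: n => //= n IHn; apply: represents_twist. Qed.

Lemma represents_twist_project w x fw a :
  represents w fw -> represents x a -> represents (twist_project w x) (ftwist_project fw a).
Proof.
move=> ww xa; apply: represents_add => //; apply: represents_opp.
exact: represents_iter_twist.
Qed.

Definition fX : form := Eval vm_compute in fadd (fexp fA 2) (fopp (fmul (fnat 64) fY)).

Lemma represents_X : represents mX fX.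
Proof.
have -> : fX = fadd (fexp fA 2) (fopp (fmul (fnat 64) fY)) by vm_compute.
rewrite mX_eq; apply: represents_add; first exact: represents_exp 2 represents_A.
exact: represents_opp (represents_mul (represents_nat 64) represents_Y).
Qed.

Definition fw5 : form := fopp (fadd (fmul (fnat 10) fP) (fmul (fnat 2) fA)).
Definition fw6 : form := fopp (fmul (fnat 6) fP).
Definition fwE2 : form := fopp (fmul (fnat 2) (fadd fA fP)).
Definition f7D6S : form := iter 5 fder f7DS.
Definition f7VS : form := fadd f7S (fopp f7D6S).

Lemma represents_7D6S : represents (7 * iter 6 (@dq _) mS) f7D6S.
Proof.
have it n : represents (7 * iter n.+1 (@dq _) mS) (iter n fder f7DS).
  elim: n => [|n IHn]; first exact: represents_7DS.
  by rewrite iterS -dq_natM; apply: represents_der.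
exact: it.
Qed.

Lemma represents_7VS : represents (7 * vq 7 mS) f7VS.
Proof.
rewrite mS_vq7; apply: represents_add represents_7S _.
exact: represents_opp represents_7D6S.
Qed.

(** The logarithmic derivatives, modulo 49, of eta(tau)^4 eta(2 tau), eta(tau)^3 and
    eta(2 tau): P/24 for eta(tau) and (A + P)/24 for eta(2 tau), with 1/24 = -2. *)
Definition mw5 : K49 := - (10 * mP + 2 * mA).
Definition mw6 : K49 := - (6 * mP).
Definition mwE2 : K49 := - (2 * (mA + mP)).

Lemma represents_w5 : represents mw5 fw5.
Proof.
apply/represents_opp/represents_add.
  exact: represents_mul (represents_nat 10) represents_P.
exact: represents_mul (represents_nat 2) represents_A.
Qed.

Lemma represents_w6 : represents mw6 fw6.
Proof. exact: represents_opp (represents_mul (represents_nat 6) represents_P). Qed.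

Lemma represents_wE2 : represents mwE2 fwE2.
Proof.
apply/represents_opp/(represents_mul (represents_nat 2)).
exact: represents_add represents_A represents_P.
Qed.

(** The exponents 4, 5 of X and Y and the constants 20, 14, 7 describe the section of
    E(q)^4 E(q^2) (1 + 7 S) found in [section5_E1p4E2]. *)
Lemma projection_identity5 : twist_project mw5 (twist_project mw5 (1 + 7 * mS)) =
  mX ^+ 4 * mY ^+ 5 * ((1 + 4 * (7 * mS))
    * (1 + 7 * vq 7 mS - 7 * (mA * mY) ^+ 7)
    * (20 + 14 * mA ^+ 21 - 7 * vq 7 mS)).
Proof.
have rw := represents_w5; have rS := represents_7S; have rV := represents_7VS.
have r1 := represents_nat 1.
apply: (@represents_eq _ _ (ftwist_project fw5 (ftwist_project fw5 (fadd (fnat 1) f7S)))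
  (fmul (fmul (fexp fX 4) (fexp fY 5))
    (fmul (fmul (fadd (fnat 1) (fmul (fnat 4) f7S))
       (fadd (fadd (fnat 1) f7VS) (fopp (fmul (fnat 7) (fexp (fmul fA fY) 7)))))
     (fadd (fadd (fnat 20) (fmul (fnat 14) (fexp fA 21))) (fopp f7VS))))).
- by apply/represents_twist_project/represents_twist_project => //; apply: represents_add.
- apply: represents_mul.
    exact: represents_mul (represents_exp 4 represents_X) (represents_exp 5 represents_Y).
  apply: represents_mul; last first.
    apply: represents_add; last exact: represents_opp.
    apply: represents_add; first exact: represents_nat 20.
    exact: represents_mul (represents_nat 14) (represents_exp 21 represents_A).
  apply: represents_mul.
    exact: represents_add r1 (represents_mul (represents_nat 4) rS).
  apply: represents_add; first exact: represents_add.
  apply/represents_opp/(represents_mul (represents_nat 7))/represents_exp.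
  exact: represents_mul represents_A represents_Y.
- by vm_compute.
Qed.

Lemma projection_identity6 : twist_project mw6 (twist_project mw6 (20 + 14 * mA ^+ 3 - 7 * mS)) =
  14 * (mX ^+ 12 * mY ^+ 6).
Proof.
have rw := represents_w6.
apply: (@represents_eq _ _ (ftwist_project fw6 (ftwist_project fw6
   (fadd (fadd (fnat 20) (fmul (fnat 14) (fexp fA 3))) (fopp f7S))))
  (fmul (fnat 14) (fmul (fexp fX 12) (fexp fY 6)))).
- apply/represents_twist_project/represents_twist_project => //.
  apply: represents_add; last exact: represents_opp represents_7S.
  apply: represents_add; first exact: represents_nat 20.
  exact: represents_mul (represents_nat 14) (represents_exp 3 represents_A).
- apply: represents_mul; first exact: represents_nat 14.
  exact: represents_mul (represents_exp 12 represents_X) (represents_exp 6 represents_Y).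
- by vm_compute.
Qed.

(** The exponents m of the theta series eta(2 tau) satisfy m^3 = -1 or m = 0 modulo 7. *)
Lemma theta_identity : 7 * (iter 4 (twist mwE2) 1 + twist mwE2 1) = 0.
Proof.
have rw := represents_wE2; have r1 := represents_nat 1.
apply: (@represents_eq _ _ (fmul (fnat 7)
    (fadd (iter 4 (ftwist fwE2) (fnat 1)) (ftwist fwE2 (fnat 1)))) (fnat 0)).
- apply: represents_mul; first exact: represents_nat 7.
  by apply: represents_add; [apply: represents_iter_twist | apply: represents_twist].
- exact: (represents_nat 0).
- by vm_compute.
Qed.

(** * Arithmetic progressions of coefficients *)

Definition section7 (r : nat) (f : K49) : K49 := Fps (fun n => f (7 * n + r)%N).

Lemma section7E r f n : section7 r f n = f (7 * n + r)%N. Proof. by []. Qed.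

Lemma section7_mul_vq r f g : (r < 7)%N -> section7 r (f * vq 7 g) = section7 r f * g.
Proof.
move=> r7; rewrite [RHS]mulrC [in LHS]mulrC; apply: fpsP => n.
rewrite section7E !fpsM.
rewrite -(big_mkord predT (fun i => vq 7 g i * f (7 * n + r - i)%N)).
rewrite -(big_mkord predT (fun j => g j * section7 r f (n - j)%N)) /index_iota !subn0.
set s := iota 0 (7 * n + r).+1; set t := iota 0 n.+1.
rewrite (bigID (fun i => 7 %| i)%N) /= [X in _ + X]big1 ?addr0; last first.
  by move=> i /negPf ndiv; rewrite vqE ndiv mul0r.
rewrite -big_filter (@big_bij _ _ _ t _ (fun j => 7 * j)%N (fun i => i %/ 7)%N).
- apply: eq_big_seq => j; rewrite /t mem_iota => jn.
  rewrite vqE dvdn_mulr // mulKn // section7E; congr (_ * f _); lia.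
- exact: iota_uniq.
- exact/filter_uniq/iota_uniq.
- move=> j; rewrite /s /t mem_iota mulKn // mem_filter mem_iota dvdn_mulr //.
  by split=> //; lia.
move=> i; rewrite /s /t mem_filter !mem_iota => /andP[/dvdnP[j ->] jn].
by rewrite mulnK // mulnC; split=> //; lia.
Qed.

Definition shifted (c : nat) (x : K49) : K49 := dq x + c%:R * x.

(** The operator (1 - (D + c)^6)^2. *)
Definition project (c : nat) (x : K49) : K49 :=
  let p y := y - iter 6 (shifted c) y in p (p x).

Lemma iter_shiftedE c m x n : iter m (shifted c) x n = (n + c)%:R ^+ m * x n.
Proof.
elim: m => [|m IHm]; first by rewrite mul1r.
by rewrite iterS fpsD fps_natM dqE IHm exprS natrD -mulr_natl; ring.
Qed.

(** (1 - m^6)^2 is 1 modulo 49 if 7 divides m; otherwise 1 - m^6 is a multiple of 7. *)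
Lemma projectE c x n : project c x n = if (7 %| n + c)%N then x n else 0.
Proof.
rewrite /project !(fpsB, iter_shiftedE).
have alg (K : comNzRingType) (y z : K) : z - y * z - y * (z - y * z) = (1 - y) ^+ 2 * z.
  by ring.
rewrite alg; have := Z49_pow6 (n + c); case: ifP => _.
  by move=> ->; rewrite subr0 expr1n mul1r.
by case=> _ ->; rewrite mul0r.
Qed.

Lemma iter_shifted_mul c w f g m : shifted c f = w * f ->
  iter m (shifted c) (f * g) = f * iter m (twist w) g.
Proof.
move=> wf; elim: m => // m IHm; rewrite !iterS IHm; move: (iter m _ g) => y.
rewrite /shifted /twist dqM; transitivity (shifted c f * y + f * dq y).
  by rewrite /shifted; ring.
by rewrite wf; ring.
Qed.

Lemma project_mul c w f g : shifted c f = w * f ->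
  project c (f * g) = f * twist_project w (twist_project w g).
Proof.
move=> wf; rewrite /project (iter_shifted_mul _ 6 wf) -mulrBr (iter_shifted_mul _ 6 wf).
by rewrite -mulrBr.
Qed.

Lemma section7_project c r f g : (7 %| r + c)%N ->
  project c f = qX _ ^+ r * vq 7 g -> section7 r f = g.
Proof.
move=> rc pf; apply: fpsP => n; rewrite section7E.
have := congr1 (fun x : K49 => coef_fps x (7 * n + r)%N) pf.
rewrite projectE -addnA dvdn_addr ?dvdn_mulr // rc => ->.
by rewrite qXnM leq_addl addnK vqE dvdn_mulr // mulKn.
Qed.

Definition mE1i := red (fps_inv (euler 1)).
Definition mE2i := red (fps_inv (euler 2)).
Lemma mE1_inv : mE1 * mE1i = 1. Proof. exact: red_unit (euler0 1). Qed.
Lemma mE2_inv : mE2 * mE2i = 1. Proof. exact: red_unit (euler0 2). Qed.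

(** 37 is 1/4 modulo 49, and q^(1/4) E(q)^4 E(q^2) is a product of eta functions;
    similarly 43 is 1/8 and 45 is 1/12 in the two lemmas that follow. *)
Lemma shifted_E1p4E2 : shifted 37 (mE1 ^+ 4 * mE2) = mw5 * (mE1 ^+ 4 * mE2).
Proof.
rewrite /shifted /mw5 dqM dqX dq_mE1 dq_mE2.
have alg (K : comNzRingType) (c49 : 49%:R = 0 :> K) (A P e1 e2 : K) :
   4%:R * e1 ^+ 3 * (- 2 * (P - 1) * e1) * e2 + e1 ^+ 4 * (- 2 * (A + P - 2) * e2)
     + 37%:R * (e1 ^+ 4 * e2) = - (10 * P + 2 * A) * (e1 ^+ 4 * e2).
  transitivity (- (10 * P + 2 * A) * (e1 ^+ 4 * e2) + 49%:R * (e1 ^+ 4 * e2)).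
    by ring.
  by rewrite c49 mul0r addr0.
exact: (alg _ fps49_49 mA mP mE1 mE2).
Qed.

Lemma shifted_E1p3 : shifted 43 (mE1 ^+ 3) = mw6 * mE1 ^+ 3.
Proof.
rewrite /shifted /mw6 dqX dq_mE1.
have alg (K : comNzRingType) (c49 : 49%:R = 0 :> K) (P e1 : K) :
   3%:R * e1 ^+ 2 * (- 2 * (P - 1) * e1) + 43%:R * e1 ^+ 3 = - (6 * P) * e1 ^+ 3.
  transitivity (- (6 * P) * e1 ^+ 3 + 49%:R * e1 ^+ 3); first ring.
  by rewrite c49 mul0r addr0.
exact: (alg _ fps49_49 mP mE1).
Qed.

Lemma shifted_E2 : shifted 45 mE2 = mwE2 * mE2.
Proof.
rewrite /shifted /mwE2 dq_mE2.
have alg (K : comNzRingType) (c49 : 49%:R = 0 :> K) (A P e2 : K) :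
   - 2 * (A + P - 2) * e2 + 45%:R * e2 = - (2 * (A + P)) * e2.
  transitivity (- (2 * (A + P)) * e2 + 49%:R * e2); first ring.
  by rewrite c49 mul0r addr0.
exact: (alg _ fps49_49 mA mP mE2).
Qed.

Lemma monomial_X4Y5 : mX ^+ 4 * mY ^+ 5 = qX _ ^+ 5 * mE1 ^+ 24 * mE2 ^+ 48.
Proof.
have alg (K : comNzRingType) (X Y q e1 e2 u1 u2 : K) : e1 * u1 = 1 -> e2 * u2 = 1 ->
    X * e2 ^+ 8 = e1 ^+ 16 -> Y * e1 ^+ 8 = q * e2 ^+ 16 ->
    X ^+ 4 * Y ^+ 5 = q ^+ 5 * e1 ^+ 24 * e2 ^+ 48.
  move=> h1 h2 hX hY; apply: (@unit_mulI _ (e1 ^+ 40 * e2 ^+ 32) (u1 ^+ 40 * u2 ^+ 32)).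
    rewrite mulrACA -!exprMn h1 h2 !expr1n mulr1 //.
  transitivity ((X * e2 ^+ 8) ^+ 4 * (Y * e1 ^+ 8) ^+ 5); first ring.
  by rewrite hX hY; ring.
exact: (alg _ mX mY (qX _) _ _ _ _ mE1_inv mE2_inv mX_euler mY_euler).
Qed.

Lemma monomial_X12Y6 : mX ^+ 12 * mY ^+ 6 = qX _ ^+ 6 * mE1 ^+ 144.
Proof.
have alg (K : comNzRingType) (X Y q e1 e2 u1 u2 : K) : e1 * u1 = 1 -> e2 * u2 = 1 ->
    X * e2 ^+ 8 = e1 ^+ 16 -> Y * e1 ^+ 8 = q * e2 ^+ 16 ->
    X ^+ 12 * Y ^+ 6 = q ^+ 6 * e1 ^+ 144.
  move=> h1 h2 hX hY; apply: (@unit_mulI _ (e1 ^+ 48 * e2 ^+ 96) (u1 ^+ 48 * u2 ^+ 96)).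
    rewrite mulrACA -!exprMn h1 h2 !expr1n mulr1 //.
  transitivity ((X * e2 ^+ 8) ^+ 12 * (Y * e1 ^+ 8) ^+ 6).
    by ring.
  by rewrite hX hY; ring.
exact: (alg _ mX mY (qX _) _ _ _ _ mE1_inv mE2_inv mX_euler mY_euler).
Qed.

Definition uE2 : K49 := vq 7 mE2.
Definition mB : K49 := 20 + 14 * mA ^+ 3 - 7 * mS.

(** The projection of the left-hand side onto the exponents 5 modulo 7 is known by
    [projection_identity5]. The right-hand side at q^7 involves E(q^7)^4 E(q^98),
    and [mE1_pow7], [mE2_pow7] turn this into E(q)^28 E(q^2)^49 up to factors 1 + 7 z. *)
Lemma section5_E1p4E2 :
  section7 5 (mE1 ^+ 4 * mE2 * (1 + 7 * mS)) = mE1 ^+ 4 * uE2 * mB.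
Proof.
apply: (@section7_project 37) => //.
rewrite (project_mul _ shifted_E1p4E2) projection_identity5 monomial_X4Y5.
have vB : vq 7 mB = 20 + 14 * vq 7 (mA ^+ 3) - 7 * vq 7 mS.
  by rewrite vqB vqD vq_nat !vq_natM.
have hv : uE2 ^+ 7 = vq 7 uE2 * (1 - 7 * (vq 7 mS - vq 7 (mA * mY))).
  by rewrite -vqX mE2_pow7 vqM vqB vq1 vq_natM vqB.
rewrite (vqM 6 (mE1 ^+ 4 * uE2)) (vqM 6 (mE1 ^+ 4)) vqX vB.
have alg (K : comNzRingType) (c49 : 49%:R = 0 :> K)
    (q e1 e2 e7 e14 v14 S A Y vS vA z : K) :
    e1 ^+ 7 = e7 * (1 - 7 * S) -> e2 ^+ 7 = e14 * (1 - 7 * (S - A * Y)) ->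
    e14 ^+ 7 = v14 * (1 - 7 * (vS - z)) -> 7 * (A * Y) ^+ 7 = 7 * z ->
    7 * (A ^+ 3) ^+ 7 = 7 * vA ->
    e1 ^+ 4 * e2 * (q ^+ 5 * e1 ^+ 24 * e2 ^+ 48 * ((1 + 4 * (7 * S)) *
      (1 + 7 * vS - 7 * (A * Y) ^+ 7) * (20 + 14 * A ^+ 21 - 7 * vS))) =
    q ^+ 5 * (e7 ^+ 4 * v14 * (20 + 14 * vA - 7 * vS)).
  move=> h1 h2 h14 hz hA.
  have inv (x y t : K) : x = y * (1 - 7 * t) -> y = x * (1 + 7 * t).
    by move=> ->; transitivity (y - 49%:R * y * t ^+ 2); [rewrite c49|]; ring.
  have pow7 (x t : K) : (x * (1 + 7 * t)) ^+ 7 = x ^+ 7.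
    rewrite exprMn; transitivity (x ^+ 7 * (1 + 49%:R * (t + 21 * t ^+ 2 + 245 * t ^+ 3
      + 1715 * t ^+ 4 + 7203 * t ^+ 5 + 16807 * t ^+ 6 + 16807 * t ^+ 7))); first ring.
    by rewrite c49; ring.
  rewrite (inv _ _ _ h1) (inv _ _ _ h14) (inv _ _ _ h2) pow7.
  have -> : 14 * A ^+ 21 = 14 * vA.
    by transitivity (2 * (7 * (A ^+ 3) ^+ 7)); [|rewrite hA]; ring.
  rewrite hz -addrA -mulrBr.
  have -> : 1 + 4 * (7 * S) = (1 + 7 * S) ^+ 4.
    apply/eqP; rewrite eq_sym -subr_eq0; apply/eqP.
    by transitivity (49%:R * (6 * S ^+ 2 + 28 * S ^+ 3 + 49%:R * S ^+ 4)); [ring|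
      rewrite c49; ring].
  by ring.
exact: (alg _ fps49_49 (qX _) mE1 mE2 (vq 7 mE1) uE2 (vq 7 uE2) mS mA mY (vq 7 mS)
  (vq 7 (mA ^+ 3)) (vq 7 (mA * mY)) mE1_pow7 mE2_pow7 hv
  (fps_frob7 _) (fps_frob7 _)).
Qed.

(** As for [section5_E1p4E2]; the factor 14 leaves only congruences modulo 7. *)
Lemma section6_E1p3 : section7 6 (mE1 ^+ 3 * mB) = 14 * vq 7 mE1 ^+ 3.
Proof.
apply: (@section7_project 43) => //.
rewrite (project_mul _ shifted_E1p3) projection_identity6 monomial_X12Y6 vq_natM vqX.
have alg (K : comNzRingType) (c49 : 49%:R = 0 :> K) (q e e7 v S : K) :
    e ^+ 7 = e7 * (1 - 7 * S) -> 7 * e7 ^+ 7 = 7 * v ->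
    e ^+ 3 * (14 * (q ^+ 6 * e ^+ 144)) = q ^+ 6 * (14%:R * v ^+ 3).
  move=> h hv; have h7 : 7 * e7 = 7 * e ^+ 7.
    by rewrite h; transitivity (7 * e7 - 49%:R * e7 * S); [rewrite c49|]; ring.
  have pw m : 7 * e7 ^+ m = 7 * (e ^+ 7) ^+ m.
    elim: m => // m IHm; rewrite exprS mulrA h7 -mulrA [_ * e7 ^+ m]mulrC.
    by rewrite mulrA IHm -mulrA -exprSr.
  have v3 : 7 * v ^+ 3 = 7 * e7 ^+ 21.
    transitivity (7 * v * v ^+ 2); first ring.
    rewrite -hv; transitivity (7 * v * (v * e7 ^+ 7)); first ring.
    rewrite -hv; transitivity (7 * v * e7 ^+ 14); first ring.
    by rewrite -hv; ring.
  transitivity (2 * q ^+ 6 * (7 * (e ^+ 7) ^+ 21)); first ring.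
  by rewrite -pw -v3; ring.
exact: (alg _ fps49_49 (qX _) mE1 (vq 7 mE1) (vq 7 (vq 7 mE1)) mS mE1_pow7
  (fps_frob7 _)).
Qed.

(** For such n, y = n + 45 is a square modulo 7, so that y^3 = 1 and y^4 + y = 2 y. *)
Lemma Z49_quartic_unit (n : nat) (y := (n + 45)%:R : 'Z_49) :
  (n %% 7)%N \in [:: 1; 5; 6]%N -> exists z, 7 * (y ^+ 4 + y) * z = 7.
Proof.
move=> nr; exists (4 * y ^+ 5); move: nr.
have -> : (n %% 7 \in [:: 1; 5; 6])%N = ((y : nat) %% 7 \in [:: 4; 1; 2])%N.
  have -> : ((y : nat) %% 7 = (n %% 7 + 3) %% 7)%N.
    by rewrite /y val_Zp_nat // modn_dvdm //; lia.
  by have := ltn_pmod n (isT : 0 < 7)%N; case: (n %% 7)%N => [|[|[|[|[|[|[|]]]]]]].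
pose P (x : 'Z_49) := ((x : nat) %% 7 \in [:: 4; 1; 2])%N ==>
  (7 * (x ^+ 4 + x) * (4 * x ^+ 5) == 7).
have Pall : all P [seq inZp i | i <- iota 0 49] by vm_compute.
by move=> h; have := Z49_all Pall y; rewrite /P h => /eqP e; exact: e.
Qed.

(** By [theta_identity], 7 (y^4 + y) annihilates the coefficient whose index plus 1/12
    is y. *)
Lemma mE2_coef_mod7 r n : r \in [:: 1; 5; 6]%N -> 7 * mE2 (7 * n + r)%N = 0.
Proof.
move=> hr; have e : 7 * (iter 4 (shifted 45) mE2 + iter 1 (shifted 45) mE2) = 0.
  rewrite -[mE2]mulr1 !(iter_shifted_mul _ _ shifted_E2) /= -mulrDr mulrCA.
  by rewrite theta_identity mulr0.
have := congr1 (fun x : K49 => coef_fps x (7 * n + r)%N) e.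
rewrite fps_natM fpsD !iter_shiftedE expr1 fps0E.
set y : 'Z_49 := (7 * n + r + 45)%:R.
have [z zE] : exists z, 7 * (y ^+ 4 + y) * z = 7.
  apply: Z49_quartic_unit; rewrite mulnC modnMDl modn_small //.
  by move: hr; rewrite !inE => /or3P[] /eqP ->.
move: (mE2 _) => x h; transitivity (7 * (y ^+ 4 + y) * z * x); first by rewrite zE.
by transitivity (z * (7 * (y ^+ 4 * x + y * x))); [ring | rewrite h mulr0].
Qed.

(** E(q^2) / E(q)^3, the generating function without its factor in q^(2 k + 1). *)
Definition core : K49 := mE2 * mE1i ^+ 3.

(** E(q^2) / E(q)^3 = E(q)^4 E(q^2) / E(q)^7, and E(q)^7 is a series in q^7 times
    1 - 7 S. *)
Lemma section5_core : section7 5 core = mE1 ^+ 3 * mB * vq 7 mE2.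
Proof.
apply: (unit_mulI mE1_inv).
transitivity (section7 5 (core * vq 7 mE1)).
  by rewrite section7_mul_vq // mulrC.
have -> : core * vq 7 mE1 = mE1 ^+ 4 * mE2 * (1 + 7 * mS).
  have alg (K : comNzRingType) (c49 : 49%:R = 0 :> K) (e u e2 v S : K) :
      e * u = 1 -> e ^+ 7 = v * (1 - 7 * S) ->
      e2 * u ^+ 3 * v = e ^+ 4 * e2 * (1 + 7 * S).
    move=> eu h; transitivity (e2 * u ^+ 3 * (v * (1 - 7 * S)) * (1 + 7 * S)
      + 49%:R * (e2 * u ^+ 3 * v * S ^+ 2)); first ring.
    rewrite -h c49 mul0r addr0.
    by transitivity (e2 * (e * u) ^+ 3 * e ^+ 4 * (1 + 7 * S)); [|rewrite eu]; ring.
  exact: (alg _ fps49_49 mE1 mE1i mE2 (vq 7 mE1) mS mE1_inv mE1_pow7).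
rewrite section5_E1p4E2 /uE2.
have alg (K : comNzRingType) (e v b : K) : e ^+ 4 * v * b = e * (e ^+ 3 * b * v) by ring.
exact: alg.
Qed.

Lemma section65_core : section7 6 (section7 5 core) = 14 * mE2 * vq 7 (mE1 ^+ 3).
Proof.
rewrite section5_core section7_mul_vq // section6_E1p3 vqX.
by rewrite mulrAC.
Qed.

Lemma section_core0 r : r \in [:: 1; 5; 6]%N ->
  section7 r (section7 6 (section7 5 core)) = 0.
Proof.
move=> hr; have r7 : (r < 7)%N by move: hr; rewrite !inE => /or3P[] /eqP ->.
rewrite section65_core section7_mul_vq //.
have -> : section7 r (14 * mE2) = 0; last by rewrite mul0r.
apply: fpsP => n; rewrite section7E fps_natM fps0E.
have := mE2_coef_mod7 n hr; move: (mE2 _) => x h.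
by transitivity (2 * (7 * x)); [ring | rewrite h mulr0].
Qed.

(** Three sections in succession, since t = 7 (7 r + 6) + 5 with r = 1, 5, 6. *)
Lemma core_coef0 (M : K49) t n : t \in [:: 96; 292; 341]%N ->
  (core * vq 343 M) (343 * n + t)%N = 0.
Proof.
move=> ht; have [r hr ->] : exists2 r, r \in [:: 1; 5; 6]%N & t = (7 * (7 * r + 6) + 5)%N.
  by move: ht; rewrite !inE => /or3P[] /eqP ->; [exists 1%N|exists 5%N|exists 6%N].
have r7 : (r < 7)%N by move: hr; rewrite !inE => /or3P[] /eqP ->.
have -> : (343 * n + (7 * (7 * r + 6) + 5) = 7 * (7 * (7 * n + r) + 6) + 5)%N by lia.
have -> : vq 343 M = vq 7 (vq 7 (vq 7 M)) by rewrite !vq_vq.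
rewrite -!section7E section7_mul_vq // section7_mul_vq // section7_mul_vq //.
by rewrite section_core0 // mul0r.
Qed.

Lemma fps_ser_mul (f g : series) : Fps f * Fps g = Fps (ser_mul f g).
Proof. by apply: fpsP => n; rewrite fpsM. Qed.

Lemma fps_ser_exp (f : series) m : Fps (ser_exp f m) = Fps f ^+ m.
Proof.
elim: m => [|m IHm]; first by apply: fpsP => n; rewrite fps1E.
by rewrite exprS -IHm fps_ser_mul.
Qed.

(** 343 divides 2 k + 1, so the remaining Euler products are series in q^343. *)
Lemma red_Delta k : (k %% 343 = 171)%N ->
  exists M, red (Fps (Delta k)) = core * vq 343 M.
Proof.
move=> hk; have [m hm] : exists m, (2 * k + 1 = 343 * m.+1)%N.
  by exists ((2 * k + 1) %/ 343).-1; lia.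
have hm2 : (2 * (2 * k + 1) = 343 * (2 * m.+1))%N by rewrite hm mulnCA.
have v343 j : red (euler (343 * j.+1)) = vq 343 (red (euler j.+1)).
  by rewrite -red_vq (euler_vq j) vq_vq -euler_vq.
pose B := red (euler (2 * m.+1)); pose Bi := red (fps_inv (euler (2 * m.+1))).
have BBi : B * Bi = 1 by apply/red_unit/euler0.
exists (red (euler m.+1) * Bi).
have gf : Fps (Delta k) * (euler 1 ^+ 3 * euler (2 * (2 * k + 1))) =
    euler 2 * euler (2 * k + 1).
  have -> : euler 1 ^+ 3 = Fps (ser_exp (qpoch 1 1) 3).
    by rewrite fps_ser_exp -euler_series.
  rewrite !euler_series !fps_ser_mul.
  by apply: fpsP => n; apply: (Delta_gf k n).
rewrite hm2 hm in gf; have := red_congr gf.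
rewrite redM (redM (euler 1 ^+ 3)) redX (redM (euler 2)) !v343.
have -> : vq 343 (red (euler (2 * m.+1))) = vq 343 B by [].
rewrite vqM => e; apply: (unit_mulI (u := mE1 ^+ 3 * vq 343 B) (v := mE1i ^+ 3 * vq 343 Bi)).
  by rewrite mulrACA -exprMn -vqM mE1_inv BBi vq1 expr1n mulr1.
have alg (K : comNzRingType) (D e1 u1 e2 b bi c : K) : e1 * u1 = 1 -> b * bi = 1 ->
    D * (e1 ^+ 3 * b) = e2 * c ->
    e1 ^+ 3 * b * D = e1 ^+ 3 * b * (e2 * u1 ^+ 3 * (c * bi)).
  move=> h1 h2 h; transitivity (D * (e1 ^+ 3 * b)); first ring.
  by rewrite h; transitivity (e2 * c * (e1 * u1) ^+ 3 * (b * bi)); [rewrite h1 h2|]; ring.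
apply: (alg _ _ _ _ _ _ _ _ mE1_inv _ e).
by rewrite -vqM BBi vq1.
Qed.

Lemma intr_Z49_eq0 (z : int) : (z%:~R : 'Z_49) = 0 -> (z = 0 %[mod 49])%Z.
Proof.
move=> z0; rewrite mod0z; have := z0; rewrite {1}(divz_eq z 49) rmorphD rmorphM /=.
rewrite -[(49 : int)]/(49%N%:R) rmorph_nat Z49_49 mulr0 add0r.
have : (0 <= z %% 49)%Z by apply: modz_ge0.
have : (z %% 49 < 49)%Z by apply: ltz_pmod.
case: (z %% 49)%Z => // m m49 _ /(congr1 (fun x : 'Z_49 => (x : nat))).
by rewrite -[(Posz m)%:~R]/(m%:R) val_Zp_nat // modn_small // => ->.
Qed.

Theorem theorem1p4 (k t : nat) (k_gt0 : (0 < k)%N)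
    (hk : k = 171 %[mod 343]) (ht : t \in [:: 96; 292; 341]%N) :
  forall n : nat, (Delta k (343 * n + t)%N = 0 %[mod 49])%Z.
Proof.
move=> n; apply: intr_Z49_eq0; have [M DM] := red_Delta hk.
by rewrite -[LHS]/(red (Fps (Delta k)) (343 * n + t)%N) DM core_coef0.
Qed.
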